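(* There exist absolute constants $l_\xi\in(0,1)$ and $c\in(0,1)$ such that the following holds. Let $\mathbb{P}$ be a probability distribution on $\mathcal{X}$ and let $\mathcal{F}$ be a convex class of functions $f:\mathcal{X}\to[-1,1]$ containing two functions $f_1,f_2$ with $\|f_1-f_2\|_{\mathbb{P}}\ge 1/2$. Then for all sufficiently large $n$ and every $f_0\in\mathcal{F}$, $$\mathbb{E}_{x,\xi}\int(\hat f_n-f_0)^2\,d\mathbb{P}\;\ge\; c\cdot\min\{\mathcal{W}(\mathcal{F})^2,\;t_{n,\mathbb{P}}(f_0,\mathcal{F})^2\},$$ where $t_{n,\mathbb{P}}(f_0,\mathcal{F})$ is defined with the constant $l_\xi$. (The threshold on $n$ does not depend on $f_0$.)
   Context: Model (random design): $X_1,\dots,X_n$ are i.i.d. from $\mathbb{P}$ on $\mathcal{X}$, $\xi_1,\dots,\xi_n$ are i.i.d. $N(0,1)$ independent of the $X_i$, and $Y_i=f_0(X_i)+\xi_i$ with $f_0\in\mathcal{F}$. The least squares estimator (ERM) is $\hat f_n=\Psi\big(\arg\min_{f\in\mathcal{F}}\sum_{i=1}^n(Y_i-f(X_i))^2\big)$, where $\Psi$ is any rule selecting one element of the set of minimizers (minimizers are assumed to exist and all quantities to be measurable). $\mathbb{E}_{x,\xi}$ is expectation over $X_1,\dots,X_n,\xi_1,\dots,\xi_n$. Notation: for a measure $\mathbb{Q}$ on $\mathcal{X}$, $\|f\|_{\mathbb{Q}}$ is the $L_2(\mathbb{Q})$ norm and $B_{\mathbb{Q}}(f,r)=\{g\in\mathcal{F}:\|g-f\|_{\mathbb{Q}}\le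 r\}$. $\mathbb{P}_n=\frac1n\sum_{i=1}^n\delta_{X_i}$ is the empirical measure and $B_n(f,r)=B_{\mathbb{P}_n}(f,r)$. For $\mathcal{G}\subseteq\mathcal{F}$ (possibly depending on $X_1,\dots,X_n$), the Gaussian averages are $\widehat{\mathcal{W}}(\mathcal{G})=\mathbb{E}_\xi\sup_{f\in\mathcal{G}}\frac1n\sum_{i=1}^n\xi_if(X_i)$ (conditionally on $X_1,\dots,X_n$), and $\mathcal{W}(\mathcal{G})=\mathbb{E}\,\widehat{\mathcal{W}}(\mathcal{G})$ (expectation over $X_1,\dots,X_n$). For a constant $l_\xi\in(0,1)$, $$t_{n,\mathbb{P}}(f_0,\mathcal{F})=\sup\{t\ge0:\ \mathcal{W}(B_{\mathbb{P}}(f_0,t))\le l_\xi\,\mathcal{W}(B_n(f_0,1))\}.$$ *)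

(* Defs.v *)
From HB Require Import structures.
From mathcomp Require Import all_boot all_order all_algebra.
From mathcomp Require Import all_classical all_reals all_analysis.
From mathcomp Require Import measurable_realfun.

Set Implicit Arguments.
Unset Strict Implicit.
Unset Printing Implicit Defensive.

Import Order.TTheory GRing.Theory Num.Theory.
Import numFieldNormedType.Exports.

Local Open Scope classical_set_scope.
Local Open Scope ring_scope.
Local Open Scope ereal_scope.

Section power_probability.
Context d (T : measurableType d) (R : realType).

Definition tcons n (p : T * n.-tuple T) : n.+1.-tuple T :=
  [the n.+1.-tuple T of p.1 :: p.2].

Lemma measurable_tcons n : measurable_fun [set: T * n.-tuple T] (@tcons n).
Proof.
exact: (measurable_cons (@measurable_fst _ _ T _) (@measurable_snd _ _ T _)).
Qed.

HB.instance Definition _ n :=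
  isMeasurableFun.Build _ _ _ _ (@tcons n) (@measurable_tcons n).

(* The n-fold product P^n, i.e. the law of n i.i.d. draws from P. *)
Fixpoint power_prob (P : probability T R) n : probability (n.-tuple T) R :=
  match n with
  | 0 => dirac [tuple]
  | m.+1 => distribution (P \x power_prob P m) (@tcons m)
  end.

End power_probability.

Section empirical_process.
Context d (T : measurableType d) (R : realType).
Implicit Types (F G : set (T -> R)) (f g : T -> R) (n : nat).

(* The default [point] of [nth] is never used: msum _ n only sees k < n. *)
Definition empirical n (x : n.-tuple T) : {measure set T -> \bar R} :=
  mscale (n%:R^-1%R : R)%:nng%R (msum (fun k => dirac (nth point x k)) n).

Definition L2ball (Q : {measure set T -> \bar R}) F f (r : R) : set (T -> R) :=
  [set g | F g /\ 'N[Q]_2%:E[EFin \o (g \- f)%R] <= r%:E].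

Definition gaussian_sup n G (x : n.-tuple T) (xi : n.-tuple R) : \bar R :=
  ereal_sup
    [set (n%:R^-1 * \sum_(i < n) tnth xi i * f (tnth x i))%R%:E | f in G].

Definition std_normal : probability (measurableTypeR R) R := normal_prob 0%R 1%R.

Definition emp_gaussian_avg n G (x : n.-tuple T) : \bar R :=
  \int[power_prob std_normal n]_xi gaussian_sup G x xi.

(* The class G x may depend on the design x. *)
Definition gaussian_avg (P : probability T R) n
    (G : n.-tuple T -> set (T -> R)) : \bar R :=
  \int[power_prob P n]_x emp_gaussian_avg (G x) x.

(* The maximum with 0 makes the supremum over t >= 0 equal to 0 when no t
   qualifies, whereas ereal_sup set0 = -oo. *)
Definition t_crit (l : R) (P : probability T R) F n f0 : \bar R :=
  maxe 0 (ereal_sup [set t%:E | t in [set t : R |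
    (0 <= t)%R /\
    gaussian_avg P (fun _ : n.-tuple T => L2ball P F f0 t) <=
    l%:E * gaussian_avg P
             (fun x : n.-tuple T => L2ball (empirical x) F f0 1%R)]]).

Definition rss n (x : n.-tuple T) (y : n.-tuple R) f : R :=
  (\sum_(i < n) (tnth y i - f (tnth x i)) ^+ 2)%R.

Definition least_squares n F (x : n.-tuple T) (y : n.-tuple R) : set (T -> R) :=
  [set f | F f /\ forall g, F g -> (rss x y f <= rss x y g)%R].

Definition selection_rule (Psi : set (T -> R) -> T -> R) : Prop :=
  forall S, S !=set0 -> S (Psi S).

Definition response n f0 (x : n.-tuple T) (xi : n.-tuple R) : n.-tuple R :=
  [tuple (f0 (tnth x i) + tnth xi i)%R | i < n].

Definition erm n (Psi : set (T -> R) -> T -> R) F f0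
    (x : n.-tuple T) (xi : n.-tuple R) : T -> R :=
  Psi (least_squares F x (response f0 x xi)).

Definition erm_loss (P : probability T R) n Psi F f0
    (w : n.-tuple T * n.-tuple R) : \bar R :=
  \int[P]_z (((erm Psi F f0 w.1 w.2 z - f0 z) ^+ 2)%R)%:E.

(* The product law makes the design and the noise independent. *)
Definition erm_risk (P : probability T R) n Psi F f0 : \bar R :=
  \int[power_prob P n \x power_prob std_normal n]_w erm_loss P Psi F f0 w.

(* Joint measurability of the suprema that define the Gaussian averages; it
   does not follow from measurability of the members of F. *)
Definition measurable_suprema (P : probability T R) F : Prop :=
  forall n,
    measurable_fun [set: n.-tuple T * n.-tuple (measurableTypeR R)]
      (fun w => gaussian_sup F w.1 w.2) /\
    forall f0, F f0 ->
      (forall t : R, (0 <= t)%R ->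
        measurable_fun [set: n.-tuple T * n.-tuple (measurableTypeR R)]
          (fun w => gaussian_sup (L2ball P F f0 t) w.1 w.2)) /\
      measurable_fun [set: n.-tuple T * n.-tuple (measurableTypeR R)]
        (fun w => gaussian_sup (L2ball (empirical w.1) F f0 1%R) w.1 w.2).

End empirical_process.

(* Main.v *)
(* Let U be the L2(P)-ball of radius t around f0 and write u = f - f0. Optimality
   of the least squares fit fhat gives, for every g in F,
     <xi, g - f0>_n <= <xi, fhat - f0>_n + 2 P_n|fhat - f0| .
   If the loss of fhat is at most t^2, then fhat lies in U, so the first term on
   the right is at most the Gaussian supremum over U, of mean W(U) <= l W(F), and
   P_n|fhat - f0| exceeds P|fhat - f0| by at most a supremum over U whose mean
   symmetrization and contraction bound by a multiple of W(U). So either the loss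
   exceeds t^2 with probability bounded below, or E P|fhat - f0| is at least a
   multiple of W(F). The exceptional event is harmless because the supremum over F
   has second moment O(W(F)^2): its variance is O(1/n) by Efron-Stein, and
   W(F)^2 is at least of order 1/n since F contains two well separated functions. *)

Require Import Defs.
From HB Require Import structures.
From mathcomp Require Import all_boot all_order all_algebra.
From mathcomp Require Import all_classical all_reals all_analysis.
From mathcomp Require Import measurable_realfun.
From mathcomp Require Import ring lra.

Set Implicit Arguments.
Unset Strict Implicit.
Unset Printing Implicit Defensive.

Import Order.TTheory GRing.Theory Num.Theory.
Import numFieldNormedType.Exports.

Local Open Scope classical_set_scope.
Local Open Scope ring_scope.
Local Open Scope ereal_scope.

(** * Powers of a probability measure *)

(** The hypotheses give measurability of Gaussian suprema only, whereas the argument integrates a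
    supremum of deviations of P_n|f - f0|. Convexity supplies what is missing: with P replaced by an
    independent ghost sample, the supremum runs over a convex set of vectors in finite dimension,
    and the support function of that set is itself a Gaussian supremum over the doubled sample. No
    event is ever given a probability. Where the loss L exceeds t^2, the supremum Z over F satisfies
    Z <= a Z^2 + 1/(4a) <= a Z^2 + L/(4 a t^2), so one inequality holds for all samples and is
    integrated once; this is why a second moment of Z is enough. The term 2 P_n|fhat - f0| is kept
    linear because the absolute value is 1-Lipschitz: contraction then costs no constant, and the
    passage from signs to Gaussians costs only 1/E|xi|. Everything is centered at f0. The noise has
    mean zero, so the averages do not change, while the suprema become nonnegative and most
    integrals can be handled in [0, +oo] by Tonelli. *)

Lemma integral_prob_cst d (T : measurableType d) (R : realType)
  (P : probability T R) (c : \bar R) : \int[P]_x c = c.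
Proof.
have -> : (fun _ : T => c) = cst c by [].
by rewrite integral_cst// [X in _ * X](@probability_setT _ _ _ P) mule1.
Qed.

Section power_probability_theory.
Context d (T : measurableType d) (R : realType).
Implicit Types (Q : probability T R).

Lemma integral_power_probS Q n (h : n.+1.-tuple T -> \bar R) :
  measurable_fun [set: n.+1.-tuple T] h -> (forall y, 0 <= h y) ->
  \int[power_prob Q n.+1]_y h y =
  \int[Q]_a \int[power_prob Q n]_y h (tcons (a, y)).
Proof.
move=> mh h0; rewrite /= ge0_integral_distribution//.
rewrite fubini_tonelli1//; last by move=> x; exact: h0.
exact: (measurableT_comp mh (@measurable_tcons _ _ n)).
Qed.

Lemma integral_power_probS_rev Q n (h : n.+1.-tuple T -> \bar R) :
  measurable_fun [set: n.+1.-tuple T] h -> (forall y, 0 <= h y) ->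
  \int[power_prob Q n.+1]_y h y =
  \int[power_prob Q n]_y \int[Q]_a h (tcons (a, y)).
Proof.
move=> mh h0; rewrite /= ge0_integral_distribution//.
rewrite fubini_tonelli2//; last by move=> x; exact: h0.
exact: (measurableT_comp mh (@measurable_tcons _ _ n)).
Qed.

Lemma tnth_tcons0 n (a : T) (y : n.-tuple T) : tnth (tcons (a, y)) ord0 = a.
Proof. by []. Qed.

Lemma tnth_tconsS n (a : T) (y : n.-tuple T) i :
  tnth (tcons (a, y)) (lift ord0 i) = tnth y i.
Proof. exact: tnthS. Qed.

Lemma measurable_tcons1 n (y : n.-tuple T) :
  measurable_fun [set: T] (fun a => tcons (a, y)).
Proof. exact: (measurableT_comp (@measurable_tcons _ _ n) (pair2_measurable _)). Qed.

Lemma measurable_tcons2 n (a : T) :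
  measurable_fun [set: n.-tuple T] (fun y => tcons (a, y)).
Proof. exact: (measurableT_comp (@measurable_tcons _ _ n) (pair1_measurable _)). Qed.

Lemma integral_power_prob_tnth Q n (i : 'I_n) (g : T -> \bar R) :
  measurable_fun [set: T] g -> (forall a, 0 <= g a) ->
  \int[power_prob Q n]_y g (tnth y i) = \int[Q]_a g a.
Proof.
move=> mg g0; elim: n i => [[]//|n IH] i.
rewrite integral_power_probS//; last first.
  by apply: measurableT_comp => //; exact: measurable_tnth.
case: (unliftP ord0 i) => [j ->|->].
  under eq_integral do under eq_integral do rewrite tnth_tconsS.
  by rewrite IH integral_prob_cst.
apply: eq_integral => a _; under eq_integral do rewrite tnth_tcons0.
by rewrite integral_prob_cst.
Qed.

End power_probability_theory.

(** * Exchange of coordinates between two independent samples *)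

Section swap.
Context d (T : measurableType d) (R : realType) (Q : probability T R).

(** Entries missing from [e] are read as [true], that is, as no exchange. [sgn] has the same
    default, so that sign +1 goes with a kept coordinate and -1 with an exchanged one. *)
Definition pick_tuple (e : seq bool) n (x x' : n.-tuple T) : n.-tuple T :=
  [tuple if nth true e i then tnth x i else tnth x' i | i < n].

Lemma measurable_pick_tuple e n :
  measurable_fun [set: n.-tuple T * n.-tuple T]
    (fun w => pick_tuple e w.1 w.2).
Proof.
apply/measurable_fun_tnthP => i.
rewrite (_ : _ \o _ = fun w : n.-tuple T * n.-tuple T =>
  if nth true e i then tnth w.1 i else tnth w.2 i); last first.
  by apply/funext => w /=; rewrite tnth_mktuple.
case: (nth true e i).
  exact: (measurableT_comp (measurable_tnth i) measurable_fst).
exact: (measurableT_comp (measurable_tnth i) measurable_snd).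
Qed.

Lemma pick_tuple_cons b e n (a a' : T) (y y' : n.-tuple T) :
  pick_tuple (b :: e) (tcons (a, y)) (tcons (a', y')) =
  tcons (if b then a else a', pick_tuple e y y').
Proof.
apply: eq_from_tnth => i; rewrite tnth_mktuple.
case: (unliftP ord0 i) => [j ->|->]; last by rewrite !tnth_tcons0; case: b.
by rewrite !tnth_tconsS tnth_mktuple.
Qed.

Lemma measurable_tcons_pair n :
  measurable_fun [set: (T * T) * n.-tuple T * n.-tuple T]
    (fun w => (tcons (w.1.1.1, w.1.2), tcons (w.1.1.2, w.2))).
Proof.
have m1 : measurable_fun [set: (T * T) * n.-tuple T * n.-tuple T]
    (fun w => w.1.1) by exact: measurableT_comp.
apply: measurable_fun_pair => /=.
- apply: (measurableT_comp (@measurable_tcons _ _ n)).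
  apply: measurable_fun_pair; first exact: (measurableT_comp measurable_fst m1).
  exact: measurableT_comp.
- apply: (measurableT_comp (@measurable_tcons _ _ n)).
  apply: measurable_fun_pair => //.
  exact: (measurableT_comp measurable_snd m1).
Qed.

Let K n (h : n.+1.-tuple T * n.+1.-tuple T -> \bar R) (c : T * T) :=
  \int[power_prob Q n]_y \int[power_prob Q n]_y'
    h (tcons (c.1, y), tcons (c.2, y')).

(** Tonelli moves the head of the second sample in front of the tail of the first, so that the two
    heads become adjacent integration variables that can be swapped. *)
Let integral_pairS n (h : n.+1.-tuple T * n.+1.-tuple T -> \bar R) :
  measurable_fun setT h -> (forall w, 0 <= h w) ->
  \int[power_prob Q n.+1]_x \int[power_prob Q n.+1]_x' h (x, x') =
  \int[Q]_a \int[Q]_a' K h (a, a').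
Proof.
move=> mh h0.
rewrite integral_power_probS; last 2 first.
- exact: (@measurable_fun_fubini_tonelli_F _ _ _ _ _ _ h).
- by move=> y; exact: integral_ge0.
apply: eq_integral => a _.
have m4 := measurableT_comp mh (@measurable_tcons_pair n).
have m3 : measurable_fun [set: n.-tuple T * T * n.-tuple T]
    (fun w => h (tcons (a, w.1.1), tcons (w.1.2, w.2))).
  apply: (measurableT_comp m4 (g := fun w : n.-tuple T * T * n.-tuple T =>
    (((a, w.1.2), w.1.1), w.2))).
  by repeat (apply: measurable_fun_pair => //); exact: measurableT_comp.
have m2 := measurable_fun_fubini_tonelli_F
  (m2 := power_prob Q n) _ m3 (fun=> h0 _).
rewrite -(fubini_tonelli _ m2) => [|w]; last exact: integral_ge0.
apply: eq_integral => y _; rewrite integral_power_probS//.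
exact: (measurableT_comp mh (pair1_measurable _)).
Qed.

Let measurable_K n (h : n.+1.-tuple T * n.+1.-tuple T -> \bar R) :
  measurable_fun setT h -> (forall w, 0 <= h w) -> measurable_fun setT (K h).
Proof.
move=> mh h0.
have m4 := measurableT_comp mh (@measurable_tcons_pair n).
have m2 := measurable_fun_fubini_tonelli_F
  (m2 := power_prob Q n) _ m4 (fun=> h0 _).
apply: (measurable_fun_fubini_tonelli_F (m2 := power_prob Q n) _ m2).
by move=> w; apply: integral_ge0 => y _; exact: h0.
Qed.

(** The two entries at each position are i.i.d., hence exchangeable. The induction exchanges the
    tails, and Tonelli swaps the two head variables when the first flag is [false]. *)
Lemma integral_swap e n (h : n.-tuple T * n.-tuple T -> \bar R) :
  measurable_fun setT h -> (forall w, 0 <= h w) ->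
  \int[power_prob Q n]_x \int[power_prob Q n]_x'
    h (pick_tuple e x x', pick_tuple e x' x) =
  \int[power_prob Q n]_x \int[power_prob Q n]_x' h (x, x').
Proof.
elim: n e h => [|n IH] e h mh h0.
  apply: eq_integral => x _; apply: eq_integral => x' _.
  by congr (h (_, _)); rewrite [LHS]tuple0 [RHS]tuple0.
have pick_nil m (y y' : m.-tuple T) : pick_tuple [::] y y' = y.
  by apply: eq_from_tnth => i; rewrite tnth_mktuple nth_nil.
case: e => [|b e].
  by apply: eq_integral => x _; apply: eq_integral => x' _; rewrite !pick_nil.
rewrite (integral_pairS (h := fun w =>
  h (pick_tuple (b :: e) w.1 w.2, pick_tuple (b :: e) w.2 w.1))); last 2 first.
- apply: (measurableT_comp mh (g := fun w : n.+1.-tuple T * n.+1.-tuple T =>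
    (pick_tuple (b :: e) w.1 w.2, pick_tuple (b :: e) w.2 w.1))).
  have mp := @measurable_pick_tuple (b :: e) n.+1.
  apply: measurable_fun_pair => //.
  exact: (measurableT_comp mp (@measurable_swap _ _ _ _)).
- by move=> w; exact: h0.
rewrite [RHS](integral_pairS mh h0).
transitivity (\int[Q]_a \int[Q]_a' (if b then K h (a, a') else K h (a', a))).
  apply: eq_integral => a _; apply: eq_integral => a' _.
  rewrite /K /=; under eq_integral do under eq_integral do rewrite !pick_tuple_cons.
  have mhc (c c' : T) : measurable_fun [set: n.-tuple T * n.-tuple T]
      (fun w => h (tcons (c, w.1), tcons (c', w.2))).
    apply: (measurableT_comp mh (g := fun w : n.-tuple T * n.-tuple T =>
      (tcons (c, w.1), tcons (c', w.2)))).
    apply: measurable_fun_pair.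
      exact: (measurableT_comp (measurable_tcons2 c) measurable_fst).
    exact: (measurableT_comp (measurable_tcons2 c') measurable_snd).
  case: b.
    by rewrite (IH e (fun w => h (tcons (a, w.1), tcons (a', w.2)))).
  by rewrite (IH e (fun w => h (tcons (a', w.1), tcons (a, w.2)))).
case: b; first by [].
rewrite /=.
have mK := measurable_K mh h0.
have K0 w : 0 <= K h w.
  by apply: integral_ge0 => y _; apply: integral_ge0 => y' _; exact: h0.
exact: (esym (fubini_tonelli (m1 := Q) (m2 := Q) (K h) mK K0)).
Qed.

End swap.

(** * The standard normal distribution *)

Section standard_normal.
Context (R : realType).
Local Notation N := (std_normal R).
Local Notation mu := (@lebesgue_measure R).

Lemma normal_pdfN (s : R) : normal_pdf 0 1 (- s) = normal_pdf 0 1 s :> R.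
Proof. by rewrite !normal_pdfE ?oner_neq0// /normal_fun !subr0 sqrrN. Qed.

Lemma std_normal_sym (A : set (measurableTypeR R)) : measurable A ->
  pushforward N (-%R : measurableTypeR R -> measurableTypeR R) A = N A.
Proof.
move=> mA; rewrite /pushforward /std_normal /= /normal_prob.
have mp : measurable_fun [set: R] (fun s => (normal_pdf 0%R 1%R s)%:E : \bar R).
  by apply/measurable_EFinP; exact: measurable_normal_pdf.
transitivity (\int[pushforward mu (-%R : _ -> measurableTypeR R)]_(s in A)
    (normal_pdf 0%R 1%R s)%:E).
  rewrite ge0_integral_pushforward//=.
  - by apply: eq_integral => s _ /=; rewrite normal_pdfN.
  - exact: measurable_funTS.
  - by move=> s _; rewrite lee_fin normal_pdf_ge0.
by apply: eq_measure_integral => //= B mB _; exact: lebesgue_measureN.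
Qed.

Lemma std_normal_integralN (f : R -> \bar R) :
  measurable_fun [set: measurableTypeR R] f -> (forall s, 0 <= f s) ->
  \int[N]_s f (- s)%R = \int[N]_s f s.
Proof.
move=> mf f0.
transitivity (\int[pushforward N
    (-%R : measurableTypeR R -> measurableTypeR R)]_s f s).
  by rewrite ge0_integral_pushforward//=.
by apply: eq_measure_integral => //= B mB _; exact: std_normal_sym.
Qed.


(** The Radon-Nikodym derivative of the normal law agrees almost everywhere with the Gaussian
    density, because both have the same integral over every measurable set. *)
Lemma std_normal_integralE (f : R -> \bar R) :
  measurable_fun [set: measurableTypeR R] f -> (forall s, 0 <= f s) ->
  \int[N]_s f s = \int[mu]_s (f s * (normal_pdf 0 1 s)%:E).
Proof.
move=> mf f0.
have dom : N `<< mu := normal_prob_dominates 0%R 1%R.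
have mp : measurable_fun [set: R] (fun s => (normal_pdf 0%R 1%R s)%:E : \bar R).
  by apply/measurable_EFinP; exact: measurable_normal_pdf.
rewrite -(Radon_Nikodym_SigmaFinite.change_of_variables dom)//.
have iRN := Radon_Nikodym_SigmaFinite.f_integrable dom.
apply: ae_eq_integral => //.
- by apply: emeasurable_funM => //; exact: measurable_int iRN.
- exact: emeasurable_funM.
- apply: ae_eqe_mul2l; apply: integral_ae_eq => //.
  by move=> A _ mA; rewrite -Radon_Nikodym_SigmaFinite.f_integral.
Qed.

(** The normal density of standard deviation 2 is the majorant: exp(-s^2/2) = exp(-s^2/8)
    exp(-3s^2/8), and 3s^2/8 <= exp(3s^2/8) gives the factor 8/3 of [C]. The ratio of the peaks
    adjusts the normalizations. *)
Lemma std_normal_sqr_lty : \int[N]_s (s ^+ 2)%:E < +oo.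
Proof.
have m2 : measurable_fun [set: R] (fun s : R => (s ^+ 2)%:E).
  by apply/measurable_EFinP; exact: measurable_funX.
have mp a : measurable_fun [set: R] (fun s => (normal_pdf 0%R a s)%:E : \bar R).
  by apply/measurable_EFinP; exact: measurable_normal_pdf.
rewrite std_normal_integralE//; last by move=> s; rewrite lee_fin sqr_ge0.
have two0 : 2%R != 0%R :> R by [].
pose C : R := (8 / 3 * (normal_peak 1 / normal_peak 2))%R.
have C0 : (0 <= C)%R by rewrite mulr_ge0// divr_ge0// normal_peak_ge0.
apply: (@le_lt_trans _ _ (\int[mu]_s (C%:E * (normal_pdf 0 2 s)%:E))).
  apply: ge0_le_integral => //.
  - by move=> s _; rewrite mule_ge0// lee_fin ?sqr_ge0 ?normal_pdf_ge0.
  - exact: (emeasurable_funM m2 (mp 1%R)).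
  - exact: (emeasurable_funM (measurable_cst C%:E) (mp 2%R)).
  move=> s _; rewrite -!EFinM lee_fin !normal_pdfE ?oner_neq0//.
  rewrite /normal_fun !subr0 expr1n.
  set p1 := normal_peak 1; set p2 := normal_peak 2.
  have p20 : p2 != 0%R by rewrite gt_eqF// normal_peak_gt0.
  have -> : (C * (p2 * expR (- s ^+ 2 / (2 ^+ 2 *+ 2))) =
    p1 * (8 / 3 * expR (- s ^+ 2 / 8)))%R.
    rewrite (_ : (2 ^+ 2 *+ 2)%R = 8%R :> R); last by ring.
    by rewrite /C -/p1 -/p2; field.
  rewrite mulrCA ler_wpM2l ?normal_peak_ge0//.
  have -> : (- s ^+ 2 / (1 *+ 2) = - s ^+ 2 / 8 + - (3 / 8 * s ^+ 2))%R.
    by field.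
  rewrite expRD mulrCA [leRHS]mulrC ler_wpM2l ?expR_ge0//.
  rewrite expRN ler_pdivrMr ?expR_gt0//.
  have := expR_ge1Dx (3 / 8 * s ^+ 2); lra.
rewrite ge0_integralZl_EFin//; last 2 first.
- by move=> s _; rewrite lee_fin normal_pdf_ge0.
- exact: (mp 2%R).
by rewrite integral_normal_pdf mule1 ltry.
Qed.

(** A zero integral would force s = 0 almost surely, but a point is Lebesgue null and hence null for
    the normal law. *)
Lemma std_normal_abs_gt0 : 0 < \int[N]_s `|s|%:E.
Proof.
rewrite lt_neqAle integral_ge0 ?andbT//; apply/eqP => /esym E.
have mid : measurable_fun [set: measurableTypeR R]
  (EFin : measurableTypeR R -> \bar R) by exact/measurable_EFinP.
have [/(_ E) [A [mA NA0 sA]] _] := ae_eq_integral_abs N measurableT mid.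
have N0 : N [set 0%R] = 0.
  have /null_content_dominatesP dom := @normal_prob_dominates R 0%R 1%R.
  by apply: dom => //; exact: lebesgue_measure_set1.
have : N [set: R] <= N A + N [set 0%R].
  apply: (@le_trans _ _ (N (A `|` [set 0%R]))); last exact: measureU2.
  apply: le_measure; rewrite ?inE//; first exact: measurableU.
  move=> s _; have [->|s0] := eqVneq s 0%R; first by right.
  by left; apply: sA => /= /(_ I) [] /eqP; rewrite (negbTE s0).
by rewrite NA0 N0 adde0 [X in X <= _](@probability_setT _ _ _ N) lee_fin ler10.
Qed.

End standard_normal.

(** * The Efron-Stein inequality *)

Section efron_stein.
Context d (T : measurableType d) (R : realType).
Implicit Types (Q : probability T R).

(* Changing a coordinate to the reference value [s0] moves [h] by at most [G]
   of that coordinate; a real random variable m satisfies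
   E m^2 <= (E m)^2 + E (m - k)^2 for every constant k. *)
Lemma efron_stein Q (G : T -> R) (s0 : T) (v : R) :
  measurable_fun [set: T] G -> (forall a, (0 <= G a)%R) ->
  \int[Q]_a (G a ^+ 2)%:E <= v%:E ->
  forall n (h : n.-tuple T -> R) (c : R),
  measurable_fun [set: n.-tuple T] h -> (forall y, (0 <= h y)%R) ->
  (forall y, (h y <= c + \sum_(i < n) G (tnth y i))%R) ->
  (forall i y y', (forall j, j != i -> tnth y j = tnth y' j) ->
    tnth y' i = s0 -> (`|h y - h y'| <= G (tnth y i))%R) ->
  exists2 M : R, \int[power_prob Q n]_y (h y)%:E = M%:E &
    \int[power_prob Q n]_y (h y ^+ 2)%:E <= (M ^+ 2 + n%:R * v)%:E.
Proof.
move=> mG G0 vG; elim=> [|n IH] h c mh h0 hc hd.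
  exists (h [tuple]).
    rewrite -[RHS](integral_prob_cst (power_prob Q 0)).
    by apply: eq_integral => y _; rewrite tuple0.
  rewrite mul0r addr0 -[leRHS](integral_prob_cst (power_prob Q 0)) le_eqVlt.
  by apply/orP; left; apply/eqP/eq_integral => y _; rewrite (tuple0 y).
have mG2 : measurable_fun [set: T] (fun a => (G a ^+ 2)%:E : \bar R).
  by apply/measurable_EFinP; exact: measurable_funX.
have ha a : exists2 M : R,
    \int[power_prob Q n]_y (h (tcons (a, y)))%:E = M%:E &
    \int[power_prob Q n]_y (h (tcons (a, y)) ^+ 2)%:E <=
      (M ^+ 2 + n%:R * v)%:E.
  apply: (IH _ (c + G a)%R) => //.
  - exact: (measurableT_comp mh (measurable_tcons2 a)).
  - move=> y; rewrite (le_trans (hc _))// big_ord_recl tnth_tcons0 addrA.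
    by under eq_bigr do rewrite tnth_tconsS.
  move=> i y y' yy' y'i; rewrite -(tnth_tconsS a y i); apply: hd => [j|].
    case: (unliftP ord0 j) => [k ->|->]; last by rewrite !tnth_tcons0.
    by rewrite !tnth_tconsS => ki; apply: yy'; apply: contraNneq ki => ->.
  by rewrite tnth_tconsS.
(* [m a] is the mean of [h] given the first coordinate. The induction hypothesis controls the
   conditional second moment by [m a ^+ 2 + n%:R * v], so it remains to bound the second moment of
   [m] by M^2 + v. *)
have /choice [m hm] : forall a, exists M : R,
    \int[power_prob Q n]_y (h (tcons (a, y)))%:E = M%:E /\
    \int[power_prob Q n]_y (h (tcons (a, y)) ^+ 2)%:E <=
      (M ^+ 2 + n%:R * v)%:E.
  by move=> a; have [M] := ha a; exists M.
have mhE : measurable_fun [set: n.+1.-tuple T] (EFin \o h).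
  exact/measurable_EFinP.
have mhtE := measurableT_comp mhE (@measurable_tcons _ _ n).
have mm : measurable_fun [set: T] m.
  apply/measurable_EFinP.
  rewrite (_ : EFin \o m = fubini_F (power_prob Q n) (EFin \o h \o @tcons _ _ n)).
    apply: measurable_fun_fubini_tonelli_F => // w.
    by rewrite lee_fin.
  by apply/funext => a; rewrite /fubini_F /= -(hm a).1.
have m0 a : (0 <= m a)%R.
  by rewrite -lee_fin -(hm a).1 integral_ge0// => y _; rewrite lee_fin.
have mhs a : measurable_fun [set: n.-tuple T] (fun y => (h (tcons (a, y)))%:E).
  by apply/measurable_EFinP; exact: (measurableT_comp mh (measurable_tcons2 a)).
have intD a r : (0 <= r)%R -> \int[power_prob Q n]_y (h (tcons (a, y)) + r)%:E =
    (m a + r)%:E.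
  move=> r0; rewrite EFinD -(hm a).1 -[X in _ + X](integral_prob_cst (power_prob Q n)).
  by rewrite -ge0_integralD//; move=> y _; rewrite lee_fin.
have hds a y : (`|h (tcons (a, y)) - h (tcons (s0, y))| <= G a)%R.
  rewrite -[X in G X](tnth_tcons0 a y); apply: hd; last by rewrite tnth_tcons0.
  move=> j; case: (unliftP ord0 j) => [k -> _|->]; last by rewrite eqxx.
  by rewrite !tnth_tconsS.
have md a : (`|m a - m s0| <= G a)%R.
  have mono b1 b2 : (forall y, h (tcons (b1, y)) <= h (tcons (b2, y)) + G a)%R ->
      (m b1 <= m b2 + G a)%R.
    move=> H; rewrite -lee_fin -(hm b1).1 -intD//; apply: ge0_le_integral => //.
    - by move=> y _; rewrite lee_fin.
    - by apply/measurable_EFinP; apply: measurable_funD => //;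
        apply/measurable_EFinP; exact: mhs.
    - by move=> y _; rewrite lee_fin.
  have H1 : (m s0 <= m a + G a)%R.
    by apply: mono => y; have := hds a y; rewrite ler_norml => /andP[? _]; lra.
  have H2 : (m a <= m s0 + G a)%R.
    by apply: mono => y; have := hds a y; rewrite ler_norml => /andP[_ ?]; lra.
  by rewrite ler_norml; apply/andP; split; lra.
have m2 : measurable_fun [set: T] (fun a => (m a ^+ 2)%:E : \bar R).
  by apply/measurable_EFinP; exact: measurable_funX.
have mmE : measurable_fun [set: T] (fun a => (m a)%:E : \bar R).
  exact/measurable_EFinP.
(* Only the square of [G] is controlled, so finiteness of the mean comes from m <= m(s0) + G <=
   m(s0) + 1 + G^2. *)
have [M hM] : exists M : R, \int[Q]_a (m a)%:E = M%:E.
  have : \int[Q]_a (m a)%:E <= (v + (1 + m s0))%:E.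
    apply: (@le_trans _ _ (\int[Q]_a ((G a ^+ 2)%:E + (1 + m s0)%:E))).
      apply: ge0_le_integral => //.
      - by move=> a _; rewrite lee_fin.
      - exact: emeasurable_funD.
      move=> a _; rewrite -EFinD lee_fin.
      have := md a; rewrite ler_norml => /andP[_ ?].
      by have := sqr_ge0 (G a - 1); rewrite sqrrB1; have := G0 a; lra.
    rewrite ge0_integralD//.
    - by rewrite integral_prob_cst [leRHS]EFinD; exact: leeD2r.
    - by move=> a _; rewrite lee_fin sqr_ge0.
    - by move=> a _; rewrite lee_fin addr_ge0.
  have : 0 <= \int[Q]_a (m a)%:E.
    by apply: integral_ge0 => a _; rewrite lee_fin.
  by case: (\int[Q]_a (m a)%:E) => // M _ _; exists M.
have M0 : (0 <= M)%R.
  by rewrite -lee_fin -hM; apply: integral_ge0 => a _; rewrite lee_fin.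
exists M.
  rewrite integral_power_probS// -hM.
  by apply: eq_integral => a _; rewrite (hm a).1.
have mh2 : measurable_fun [set: n.+1.-tuple T] (fun y => (h y ^+ 2)%:E : \bar R).
  by apply/measurable_EFinP; exact: measurable_funX.
rewrite integral_power_probS//; last by move=> y; rewrite lee_fin sqr_ge0.
have v0 : (0 <= v)%R.
  by rewrite -lee_fin (le_trans _ vG)//; apply: integral_ge0 => a _;
    rewrite lee_fin sqr_ge0.
have nv0 : (0 <= n%:R * v)%R by rewrite mulr_ge0.
apply: (@le_trans _ _ (\int[Q]_a ((m a ^+ 2)%:E + (n%:R * v)%:E))).
  apply: ge0_le_integral => //.
  - by move=> a _; apply: integral_ge0 => y _; rewrite lee_fin sqr_ge0.
  - apply: (measurable_fun_fubini_tonelli_F (m2 := power_prob Q n)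
      _ (measurableT_comp mh2 (@measurable_tcons _ _ n))).
    by move=> w; rewrite lee_fin sqr_ge0.
  - exact: emeasurable_funD.
  - by move=> a _; rewrite -EFinD; exact: (hm a).2.
rewrite ge0_integralD//; last by move=> a _; rewrite lee_fin sqr_ge0.
rewrite integral_prob_cst.
set k := m s0; have k0 : (0 <= k)%R := m0 s0.
(* This is E (m - k)^2 <= E G^2 with the cross term moved to the right, which keeps both integrands
   nonnegative. Together with 2 k M - k^2 <= M^2 it gives E m^2 <= M^2 + v. *)
have : \int[Q]_a ((m a ^+ 2)%:E + (k ^+ 2)%:E) <=
    \int[Q]_a ((G a ^+ 2)%:E + (2 * k)%:E * (m a)%:E).
  apply: ge0_le_integral => //.
  - by move=> a _; rewrite -EFinD lee_fin addr_ge0 ?sqr_ge0.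
  - exact: emeasurable_funD.
  - by apply: emeasurable_funD => //; exact: emeasurable_funM.
  move=> a _; rewrite -EFinM -!EFinD lee_fin -subr_ge0.
  have -> : (G a ^+ 2 + 2 * k * m a - (m a ^+ 2 + k ^+ 2) =
    G a ^+ 2 - `|m a - k| ^+ 2)%R by rewrite real_normK ?num_real//; ring.
  by rewrite subr_ge0 lerXn2r ?nnegrE// md.
rewrite ge0_integralD//; try by move=> a _; rewrite lee_fin sqr_ge0.
rewrite integral_prob_cst ge0_integralD//; last 3 first.
- by move=> a _; rewrite lee_fin sqr_ge0.
- by move=> a _; rewrite -EFinM lee_fin !mulr_ge0.
- exact: emeasurable_funM.
rewrite ge0_integralZl_EFin//; last 2 first.
- by move=> a _; rewrite lee_fin.
- by rewrite mulr_ge0.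
rewrite hM => H.
have {}H : \int[Q]_a (m a ^+ 2)%:E + (k ^+ 2)%:E <= (v + 2 * k * M)%:E.
  by apply: (le_trans H); rewrite [leRHS]EFinD EFinM; exact: leeD2r.
move: H; set J := \int[Q]_a _.
have : 0 <= J by apply: integral_ge0 => a _; rewrite lee_fin sqr_ge0.
case: J => // r _; rewrite -!EFinD !lee_fin => H.
rewrite -natr1 mulrDl mul1r.
by have := sqr_ge0 (M - k); rewrite sqrrB; lra.
Qed.

End efron_stein.

(** * Suprema and averages over signs *)

Section bounded_suprema.
Local Open Scope ring_scope.
Context (R : realType) (I : Type).
Implicit Types (D : set I) (f g : I -> R).

(** The real supremum takes the default value 0 on empty or unbounded sets; this is why nonemptiness
    and [bounded_on_set] accompany it throughout. *)
Definition sup_on D f : R := sup [set f i | i in D].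

Definition bounded_on_set D f := exists M, forall i, D i -> `|f i| <= M.

Lemma sup_on_ub D f i : bounded_on_set D f -> D i -> f i <= sup_on D f.
Proof.
move=> [M fM] Di; apply: ub_le_sup; last by exists i.
by exists M => _ [j Dj <-]; rewrite (le_trans (ler_norm _)) ?fM.
Qed.

Lemma sup_on_le D f M : D !=set0 -> (forall i, D i -> f i <= M) ->
  sup_on D f <= M.
Proof.
move=> [i Di] fM; apply: ge_sup; first by exists (f i), i.
by move=> _ [j Dj <-]; exact: fM.
Qed.

Lemma bounded_on_cst D a : bounded_on_set D (fun=> a).
Proof. by exists `|a|. Qed.

Lemma bounded_onD D f g : bounded_on_set D f -> bounded_on_set D g ->
  bounded_on_set D (fun i => f i + g i).
Proof.
move=> [M fM] [M' gM]; exists (M + M') => i Di.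
by rewrite (le_trans (ler_normD _ _))// lerD ?fM ?gM.
Qed.

Lemma bounded_onZ D a f : bounded_on_set D f ->
  bounded_on_set D (fun i => a * f i).
Proof.
move=> [M fM]; exists (`|a| * M) => i Di.
by rewrite normrM ler_wpM2l ?fM.
Qed.

Lemma bounded_on_sum D n (f : I -> 'I_n -> R) :
  (forall j, bounded_on_set D (f^~ j)) ->
  bounded_on_set D (fun i => \sum_(j < n) f i j).
Proof.
move=> bf; have /choice [M fM] : forall j, exists M, forall i, D i ->
  `|f i j| <= M by exact: bf.
exists (\sum_(j < n) M j) => i Di.
by rewrite (le_trans (ler_norm_sum _ _ _))// ler_sum// => j _; exact: fM.
Qed.

End bounded_suprema.

(** * Averages over random signs: contraction, moments and a Khintchine bound *)

Section sign_average.
Local Open Scope ring_scope.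
Context (R : realType).

(** The expectation over n independent Rademacher signs, with [true] for +1. Being a finite average,
    it raises no measurability question in the contraction argument. *)
Fixpoint sign_avg n (H : seq bool -> R) : R :=
  if n is m.+1 then
    (sign_avg m (fun e => H (true :: e)) +
     sign_avg m (fun e => H (false :: e))) / 2
  else H [::].

Definition sgn (e : seq bool) i : R := if nth true e i then 1 else -1.

Definition signed_sum (e : seq bool) n (v : 'I_n -> R) : R :=
  \sum_(j < n) sgn e j * v j.

Lemma signed_sum_cons b e n (v : 'I_n.+1 -> R) :
  signed_sum (b :: e) v =
  (if b then v ord0 else - v ord0) + signed_sum e (fun j => v (lift ord0 j)).
Proof.
rewrite /signed_sum big_ord_recl; congr (_ + _).
by rewrite /sgn /=; case: b; rewrite ?mul1r ?mulN1r.
Qed.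

Lemma sign_avg_le n (H K : seq bool -> R) :
  (forall e, H e <= K e) -> sign_avg n H <= sign_avg n K.
Proof.
elim: n H K => [|n IH] H K HK /=; first exact: HK.
by rewrite ler_pM2r ?invr_gt0// lerD ?IH.
Qed.

Lemma sign_avg_eq n (H K : seq bool -> R) :
  (forall e, H e = K e) -> sign_avg n H = sign_avg n K.
Proof. by move=> /funext ->. Qed.

Lemma sign_avgD n (H K : seq bool -> R) :
  sign_avg n (fun e => H e + K e) = sign_avg n H + sign_avg n K.
Proof. by elim: n H K => //= n IH H K; rewrite !IH; field. Qed.

Lemma sign_avgZ n a (H : seq bool -> R) :
  sign_avg n (fun e => a * H e) = a * sign_avg n H.
Proof. by elim: n H => //= n IH H; rewrite !IH; field. Qed.

Lemma sign_avg_cst n a : sign_avg n (fun=> a) = a.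
Proof. by elim: n => //= n ->; field. Qed.

(** The Ledoux-Talagrand contraction principle, one coordinate at a time. The arbitrary offset [c]
    makes the induction work, since it absorbs the coordinate whose sign is already fixed. *)
Lemma sign_avg_contraction I (D : set I) n (c : I -> R)
    (phi v : I -> 'I_n -> R) :
  D !=set0 -> bounded_on_set D c ->
  (forall j, bounded_on_set D (phi^~ j)) ->
  (forall j, bounded_on_set D (v^~ j)) ->
  (forall j i i', D i -> D i' -> `|phi i j - phi i' j| <= `|v i j - v i' j|) ->
  sign_avg n (fun e => sup_on D (fun i => c i + signed_sum e (phi i))) <=
  sign_avg n (fun e => sup_on D (fun i => c i + signed_sum e (v i))).
Proof.
move=> D0; elim: n c phi v => [|n IH] c phi v bc bphi bv phiv.
  rewrite /=; under eq_fun do rewrite /signed_sum big_ord0.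
  by under [X in _ <= sup_on _ X]eq_fun do rewrite /signed_sum big_ord0.
rewrite /= ler_pM2r ?invr_gt0//.
pose phi' i j := phi i (lift ord0 j); pose v' i j := v i (lift ord0 j).
pose T (b : bool) (x : R) := if b then x else - x.
have bT b (w : I -> 'I_n.+1 -> R) : (forall j, bounded_on_set D (w^~ j)) ->
    bounded_on_set D (fun i => c i + T b (w i ord0)).
  move=> bw; apply: bounded_onD => //; case: b; first exact: bw.
  by have [M wM] := bw ord0; exists M => i Di; rewrite normrN wM.
have bs e m (w : I -> 'I_m -> R) : (forall j, bounded_on_set D (w^~ j)) ->
    bounded_on_set D (fun i => signed_sum e (w i)).
  by move=> bw; apply: bounded_on_sum => j; apply: bounded_onZ.
have cons b (w : I -> 'I_n.+1 -> R) :
    (fun e => sup_on D (fun i => c i + signed_sum (b :: e) (w i))) =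
    (fun e => sup_on D (fun i => (c i + T b (w i ord0)) +
       signed_sum e (fun j => w i (lift ord0 j)))).
  apply/funext => e; congr sup_on; apply/funext => i.
  by rewrite signed_sum_cons addrA.
rewrite !cons; apply: (@le_trans _ _
  (sign_avg n (fun e => sup_on D (fun i => (c i + T true (phi i ord0)) +
     signed_sum e (v' i))) +
   sign_avg n (fun e => sup_on D (fun i => (c i + T false (phi i ord0)) +
     signed_sum e (v' i))))).
  by apply: lerD; apply: IH => //; try exact: bT; move=> j;
    first [exact: bphi|exact: bv|exact: phiv].
(* With the other signs fixed, the two suprema are tested at i and j. The difference of the [phi] at
   coordinate 0 is at most |v i - v j|, which is attained by using i for the plus sign and j for the
   minus sign, or the reverse, according to the sign of v i - v j. *)
rewrite -!sign_avgD; apply: sign_avg_le => e.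
have bvc b : bounded_on_set D (fun i => c i + T b (v i ord0) +
    signed_sum e (v' i)).
  by apply: bounded_onD; [exact: bT|apply: bs => j; exact: bv].
have ub b k : D k -> c k + T b (v k ord0) + signed_sum e (v' k) <=
    sup_on D (fun i => c i + T b (v i ord0) + signed_sum e (v' i)).
  by move=> Dk; exact: (sup_on_ub (bvc b) Dk).
move: (ub true) (ub false).
move: (sup_on D (fun i => c i + T true (v i ord0) + signed_sum e (v' i))).
move: (sup_on D (fun i => c i + T false (v i ord0) + signed_sum e (v' i))).
move=> sF sT {}ubT ubF.
rewrite -lerBrDr; apply: sup_on_le => // i Di.
rewrite lerBrDr -lerBrDl; apply: sup_on_le => // j Dj; rewrite lerBrDl.
have := phiv ord0 _ _ Di Dj; rewrite ler_norml => /andP[h5 h6].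
move: (ubT _ Di) (ubF _ Di) (ubT _ Dj) (ubF _ Dj) => /= h1 h2 h3 h4.
move: h5 h6; have [d0|d0] := ger0P (v i ord0 - v j ord0); lra.
Qed.

Lemma sign_avg_sqr n s (a : 'I_n -> R) :
  sign_avg n (fun e => (s + signed_sum e a) ^+ 2) =
  s ^+ 2 + \sum_(j < n) a j ^+ 2.
Proof.
elim: n s a => [|n IH] s a; first by rewrite /= /signed_sum !big_ord0 !addr0.
have E b : sign_avg n (fun e => (s + signed_sum (b :: e) a) ^+ 2) =
    sign_avg n (fun e => (s + (if b then a ord0 else - a ord0) +
      signed_sum e (fun j => a (lift ord0 j))) ^+ 2).
  by apply: sign_avg_eq => e; rewrite signed_sum_cons addrA.
rewrite /= big_ord_recl (E true) (E false).
by rewrite !IH; field.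
Qed.

(** The shift [s] carries the signs already fixed. Odd powers cancel between the two values of the
    next sign, and the bound exceeds the average by a multiple of the fourth power of the
    coefficient. *)
Lemma sign_avg_pow4_le n s (a : 'I_n -> R) (A := \sum_(j < n) a j ^+ 2) :
  sign_avg n (fun e => (s + signed_sum e a) ^+ 4) <=
  s ^+ 4 + 6 * s ^+ 2 * A + 3 * A ^+ 2.
Proof.
rewrite /A {A}; elim: n s a => [|n IH] s a.
  by rewrite /= /signed_sum !big_ord0 addr0; lra.
have E b : sign_avg n (fun e => (s + signed_sum (b :: e) a) ^+ 4) =
    sign_avg n (fun e => (s + (if b then a ord0 else - a ord0) +
      signed_sum e (fun j => a (lift ord0 j))) ^+ 4).
  by apply: sign_avg_eq => e; rewrite signed_sum_cons addrA.
rewrite /= big_ord_recl (E true) (E false).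
have := IH (s + a ord0) (fun j => a (lift ord0 j)).
have := IH (s - a ord0) (fun j => a (lift ord0 j)).
set A := \sum_(j < n) _; set x := sign_avg _ _; set y := sign_avg _ _ => h1 h2.
rewrite ler_pdivrMr//.
apply: (le_trans (lerD h2 h1)); rewrite -subr_ge0.
have -> : (s ^+ 4 + 6 * s ^+ 2 * (a ord0 ^+ 2 + A) +
   3 * (a ord0 ^+ 2 + A) ^+ 2) * 2 -
  ((s + a ord0) ^+ 4 + 6 * (s + a ord0) ^+ 2 * A + 3 * A ^+ 2 +
   ((s - a ord0) ^+ 4 + 6 * (s - a ord0) ^+ 2 * A + 3 * A ^+ 2)) =
  4 * (a ord0 ^+ 2) ^+ 2 by ring.
by rewrite mulr_ge0// sqr_ge0.
Qed.

(** Averaging |x| >= x^2/r - x^4/(4 r^3) gives at least A/r - 3 A^2/(4 r^3), and the condition on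
    [r] makes this at least A/(2r). A free [r], instead of the square root of A, yields a bound
    linear in A, which can later be integrated over the design. *)
Lemma khintchine_lower n (a : 'I_n -> R) r (A := \sum_(j < n) a j ^+ 2) :
  0 < r -> 3 * A <= 2 * r ^+ 2 ->
  A / (2 * r) <= sign_avg n (fun e => `|signed_sum e a|).
Proof.
move=> r0 Ar.
have A0 : 0 <= A by apply: sumr_ge0 => j _; exact: sqr_ge0.
apply: (@le_trans _ _ (sign_avg n (fun e =>
    r^-1 * (0 + signed_sum e a) ^+ 2 +
    - (4 * r ^+ 3)^-1 * (0 + signed_sum e a) ^+ 4))).
  rewrite sign_avgD !sign_avgZ sign_avg_sqr mulNr.
  have := sign_avg_pow4_le 0 a; rewrite -/A !expr0n /= mulr0 mul0r !add0r => h4.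
  have r30 : 0 < (4 * r ^+ 3)^-1 by rewrite invr_gt0 mulr_gt0// exprn_gt0.
  rewrite lerBrDr; apply: (@le_trans _ _ (A / (2 * r) +
     (4 * r ^+ 3)^-1 * (3 * A ^+ 2))).
    by rewrite lerD2l ler_pM2l.
  rewrite -subr_ge0.
  have -> : r^-1 * A - (A / (2 * r) + (4 * r ^+ 3)^-1 * (3 * A ^+ 2)) =
    A * (2 * r ^+ 2 - 3 * A) * (4 * r ^+ 3)^-1.
    by field; rewrite gt_eqF.
  by rewrite mulr_ge0 ?(ltW r30)// mulr_ge0// subr_ge0.
apply: sign_avg_le => e; rewrite add0r.
set x := signed_sum e a.
have r30 : 0 < (4 * r ^+ 3)^-1 by rewrite invr_gt0 mulr_gt0// exprn_gt0.
have x4 : x ^+ 4 = `|x| ^+ 4 by rewrite -[RHS]normrX ger0_norm// exprn_even_ge0.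
have x2 : x ^+ 2 = `|x| ^+ 2 by rewrite real_normK// num_real.
rewrite x4 x2; move: `|x| (normr_ge0 x) => {x4 x2} y y0; rewrite -subr_ge0.
have -> : y - (r^-1 * y ^+ 2 + - (4 * r ^+ 3)^-1 * y ^+ 4) =
  y * (4 * r ^+ 3 - 4 * r ^+ 2 * y + y ^+ 3) * (4 * r ^+ 3)^-1.
  by field; rewrite gt_eqF.
rewrite mulr_ge0 ?(ltW r30)// mulr_ge0//.
(* A positivity certificate: the cubic has its minimum on y >= 0 at y = 2r/sqrt 3, and 6/5 is a
   rational approximation of 2/sqrt 3. *)
have -> : 4 * r ^+ 3 - 4 * r ^+ 2 * y + y ^+ 3 =
  (y - 6 / 5 * r) ^+ 2 * (y + 12 / 5 * r) + 8 / 25 * (r ^+ 2 * y) +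
  68 / 125 * r ^+ 3 by field.
have r0' := ltW r0.
rewrite !addr_ge0//; apply: mulr_ge0 => //; try exact: exprn_ge0.
- exact: sqr_ge0.
- by rewrite addr_ge0// mulr_ge0.
- by rewrite mulr_ge0// sqr_ge0.
Qed.

End sign_average.

(** * Comparison of sign averages with Gaussian averages *)

Section gaussianization.
Context (R : realType).
Local Notation N := (std_normal R).

Definition std_normal_abs_mean : R := fine (\int[N]_s `|s|%:E).
Local Notation kap := std_normal_abs_mean.

Lemma measurable_abs_EFin :
  measurable_fun [set: measurableTypeR R] (fun s : R => `|s|%:E : \bar R).
Proof. by apply/measurable_EFinP; exact: normr_measurable. Qed.

Lemma measurable_sqr_EFin :
  measurable_fun [set: measurableTypeR R] (fun s : R => (s ^+ 2)%:E : \bar R).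
Proof. by apply/measurable_EFinP; exact: measurable_funX. Qed.

Lemma std_normal_abs_meanE : \int[N]_s `|s|%:E = kap%:E.
Proof.
rewrite fineK// ge0_fin_numE; last by apply: integral_ge0 => s _; rewrite lee_fin.
apply: (@le_lt_trans _ _ (\int[N]_s (1 + (s ^+ 2)%:E))).
  apply: ge0_le_integral => //.
  - exact: measurable_abs_EFin.
  - by apply: emeasurable_funD => //; exact: measurable_sqr_EFin.
  move=> s _; rewrite -EFinD lee_fin.
  have := sqr_ge0 (`|s| - 1)%R; rewrite sqrrB1 real_normK ?num_real//.
  by have := normr_ge0 s; lra.
rewrite ge0_integralD//; last 2 first.
- by move=> s _; rewrite lee_fin sqr_ge0.
- exact: measurable_sqr_EFin.
rewrite integral_prob_cst; apply: lte_add_pinfty; first exact: (ltry 1%R).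
exact: std_normal_sqr_lty.
Qed.

Lemma std_normal_abs_mean_gt0 : (0 < kap)%R.
Proof. by rewrite -lte_fin -std_normal_abs_meanE std_normal_abs_gt0. Qed.

(** By symmetry the integral is that of (h(|s|) + h(-|s|))/2, and Jensen's inequality replaces |s|
    by its mean [kap]. Since [h] is a supremum of affine functions, it suffices to integrate the
    affine lower bound given by each pair of indices and to take suprema afterwards. *)
Lemma std_normal_jensen I (D : set I) (c v : I -> R)
    (h := fun s : R => sup_on D (fun i => c i + s * v i)%R) :
  D !=set0 -> bounded_on_set D c -> bounded_on_set D v ->
  measurable_fun [set: measurableTypeR R] h -> (forall s, (0 <= h s)%R) ->
  ((h kap + h (- kap)) / 2)%:E <= \int[N]_s (h s)%:E.
Proof.
move=> D0 bc bv mh h0.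
have mhE : measurable_fun [set: measurableTypeR R] (fun s => (h s)%:E : \bar R).
  exact/measurable_EFinP.
have mhN : measurable_fun [set: measurableTypeR R]
    (fun s => (h (- s)%R)%:E : \bar R).
  apply: (measurableT_comp mhE (g := fun s : measurableTypeR R => (- s)%R)).
  exact: measurable_funN.
have hN := std_normal_integralN mhE (fun s => h0 s).
have J0 : 0 <= \int[N]_s (h s)%:E.
  by apply: integral_ge0 => s _; rewrite lee_fin.
case EJ : (\int[N]_s (h s)%:E) J0 => [J| |//] _; last by rewrite leey.
have hub s i : D i -> (c i + s * v i <= h s)%R.
  by move=> Di; apply: (sup_on_ub (f := fun i => c i + s * v i)%R) => //; apply: bounded_onD => //;
    exact: bounded_onZ.
have key i j : D i -> D j ->
    ((c i + kap * v i) + (c j + - kap * v j) <= 2 * J)%R.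
  (* The terms in [B] and [C] are added to both sides only to make the integrands nonnegative; they
     cancel after integration. *)
  move=> Di Dj; pose B := `|v i - v j|%R; pose C := `|c i + c j|%R.
  have : \int[N]_s ((c i + c j + C)%:E + (v i - v j + B)%:E * `|s|%:E) <=
      \int[N]_s ((h s)%:E + (h (- s)%R)%:E + (C%:E + B%:E * `|s|%:E)).
    have Cge : (0 <= c i + c j + C)%R.
      by have := ler_norm (- (c i + c j))%R; rewrite normrN -/C; lra.
    have Bge : (0 <= v i - v j + B)%R.
      by have := ler_norm (- (v i - v j))%R; rewrite normrN -/B; lra.
    apply: ge0_le_integral => //.
    - by move=> s _; rewrite -EFinM -EFinD lee_fin addr_ge0// ?mulr_ge0.
    - by apply: emeasurable_funD => //; apply: emeasurable_funM => //;
        exact: measurable_abs_EFin.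
    - apply: emeasurable_funD; first exact: emeasurable_funD.
      by apply: emeasurable_funD => //; apply: emeasurable_funM => //;
        exact: measurable_abs_EFin.
    move=> s _; rewrite -!EFinM -!EFinD lee_fin.
    have : (c i + c j + (v i - v j) * `|s| <= h s + h (- s))%R.
      have := hub s _ Di; have := hub s _ Dj.
      have := hub (- s)%R _ Di; have := hub (- s)%R _ Dj.
      by have [s0|s0] := ger0P s; lra.
    by lra.
  have mB b : measurable_fun [set: measurableTypeR R]
      (fun s : R => b%:E * `|s|%:E : \bar R).
    by apply: emeasurable_funM => //; exact: measurable_abs_EFin.
  have intB b : (0 <= b)%R -> \int[N]_s (b%:E * `|s|%:E) = (b * kap)%:E.
    move=> b0; rewrite ge0_integralZl_EFin// ?std_normal_abs_meanE//.
    exact: measurable_abs_EFin.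
  have Cge : (0 <= c i + c j + C)%R.
    by have := ler_norm (- (c i + c j))%R; rewrite normrN -/C; lra.
  have Bge : (0 <= v i - v j + B)%R.
    by have := ler_norm (- (v i - v j))%R; rewrite normrN -/B; lra.
  have nB b : (0 <= b)%R -> forall s : R, setT s -> 0 <= b%:E * `|s|%:E.
    by move=> b0 s _; rewrite -EFinM lee_fin mulr_ge0.
  have mCB a b : measurable_fun [set: measurableTypeR R]
      (fun s : R => a%:E + b%:E * `|s|%:E : \bar R).
    exact: emeasurable_funD.
  rewrite ge0_integralD//; last exact: nB.
  rewrite intB// integral_prob_cst.
  have mhh : measurable_fun [set: measurableTypeR R]
      (fun s => (h s)%:E + (h (- s)%R)%:E : \bar R) by exact: emeasurable_funD.
  have hh0 s : setT s -> 0 <= (h s)%:E + (h (- s)%R)%:E.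
    by move=> _; rewrite -EFinD lee_fin addr_ge0.
  have CB0 s : setT s -> 0 <= C%:E + B%:E * `|s|%:E.
    move=> _; rewrite -EFinM -EFinD lee_fin.
    exact: addr_ge0 (normr_ge0 _) (mulr_ge0 (normr_ge0 _) (normr_ge0 _)).
  rewrite ge0_integralD//; last exact: CB0.
  rewrite ge0_integralD//; try by move=> s _; rewrite lee_fin.
  rewrite ge0_integralD//; last 2 first.
  - by move=> s _; rewrite lee_fin; exact: normr_ge0.
  - by apply: nB; exact: normr_ge0.
  rewrite hN EJ (intB B (normr_ge0 _)) integral_prob_cst -!EFinD lee_fin.
  by lra.
rewrite lee_fin ler_pdivrMr// mulrC -lerBrDr.
apply: sup_on_le => // i Di; rewrite lerBrDr -lerBrDl.
by apply: sup_on_le => // j Dj; rewrite lerBrDl; exact: key.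
Qed.

Definition weighted_sum n (xi : n.-tuple R) (v : 'I_n -> R) : R :=
  (\sum_(j < n) tnth xi j * v j)%R.

Lemma weighted_sum_cons n s (xi : n.-tuple R) (v : 'I_n.+1 -> R) :
  weighted_sum (tcons (s, xi)) v =
  (s * v ord0 + weighted_sum xi (fun j => v (lift ord0 j)))%R.
Proof.
rewrite /weighted_sum big_ord_recl tnth_tcons0; congr (_ + _)%R.
by apply: eq_bigr => j _; rewrite tnth_tconsS.
Qed.

Lemma bounded_on_weighted_sum I (D : set I) n (xi : n.-tuple R)
    (v : I -> 'I_n -> R) : (forall j, bounded_on_set D (v^~ j)) ->
  bounded_on_set D (fun i => weighted_sum xi (v i)).
Proof. by move=> bv; apply: bounded_on_sum => j; exact: bounded_onZ. Qed.

(** Each Gaussian coordinate is replaced by [kap] times a random sign through the one-dimensional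
    Jensen step. As in the contraction lemma, the offset [c] receives the coordinate already
    treated. *)
Lemma sign_avg_le_gaussian I (D : set I) n (c : I -> R) (v : I -> 'I_n -> R)
    (H := fun xi : n.-tuple R =>
      sup_on D (fun i => c i + weighted_sum xi (v i))%R) :
  D !=set0 -> bounded_on_set D c -> (forall j, bounded_on_set D (v^~ j)) ->
  measurable_fun [set: n.-tuple (measurableTypeR R)] H ->
  (forall xi, (0 <= H xi)%R) ->
  (sign_avg n (fun e =>
    sup_on D (fun i => c i + signed_sum e (fun j => kap * v i j))%R))%:E <=
  \int[power_prob N n]_xi (H xi)%:E.
Proof.
rewrite {}/H => D0; elim: n c v => [|n IH] c v bc bv mH H0.
  rewrite [leLHS](_ : _ = \int[power_prob N 0]_xi
      (sup_on D (fun i => c i + weighted_sum xi (v i))%R)%:E)//.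
  rewrite -[LHS](integral_prob_cst (power_prob N 0)).
  apply: eq_integral => xi _ /=; congr (sup_on D _)%:E; apply/funext => i.
  by rewrite /signed_sum /weighted_sum !big_ord0.
have mHE : measurable_fun [set: n.+1.-tuple (measurableTypeR R)] (fun xi =>
    (sup_on D (fun i => c i + weighted_sum xi (v i))%R)%:E : \bar R).
  exact/measurable_EFinP.
(* The head is integrated first, with the tail fixed, so that [std_normal_jensen] applies to it; the
   induction hypothesis then treats the tail for each of the two offsets [c' kap] and
   [c' (- kap)]. *)
rewrite integral_power_probS_rev//.
pose v' i j := v i (lift ord0 j).
pose c' s i := (c i + s * v i ord0)%R.
have Hcons s xi : sup_on D (fun i => c i + weighted_sum (tcons (s, xi)) (v i))%R =
    sup_on D (fun i => c' s i + weighted_sum xi (v' i))%R.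
  by congr sup_on; apply/funext => i; rewrite weighted_sum_cons addrA.
pose H1 s xi := sup_on D (fun i => c' s i + weighted_sum xi (v' i))%R.
have H10 s xi : (0 <= H1 s xi)%R by rewrite /H1 -Hcons.
have mH1 s : measurable_fun [set: n.-tuple (measurableTypeR R)] (H1 s).
  rewrite (_ : H1 s = (fun xi => sup_on D (fun i =>
    c i + weighted_sum xi (v i))%R) \o (fun xi => tcons (s, xi))).
    exact: (measurableT_comp mH (@measurable_tcons2 _ (measurableTypeR R) n s)).
  by apply/funext => xi /=; rewrite Hcons.
have mH1E s : measurable_fun [set: n.-tuple (measurableTypeR R)]
  (fun xi => (H1 s xi)%:E : \bar R) by exact/measurable_EFinP.
have bc' s : bounded_on_set D (c' s).
  by apply: bounded_onD => //; exact: bounded_onZ.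
have bv' j : bounded_on_set D (v'^~ j) by exact: bv.
have IHs s : (sign_avg n (fun e =>
    sup_on D (fun i => c' s i + signed_sum e (fun j => kap * v' i j))%R))%:E <=
    \int[power_prob N n]_xi (H1 s xi)%:E.
  by apply: IH => //; [exact: mH1|exact: H10].
apply: (@le_trans _ _ (\int[power_prob N n]_xi
    ((2^-1)%:E * ((H1 kap xi)%:E + (H1 (- kap)%R xi)%:E)))).
  rewrite ge0_integralZl_EFin//; last 2 first.
  - by move=> xi _; rewrite -EFinD lee_fin addr_ge0.
  - exact: emeasurable_funD.
  rewrite ge0_integralD//; try by move=> xi _; rewrite lee_fin.
  rewrite /= mulrC EFinM; apply: lee_wpmul2l; first by rewrite lee_fin.
  rewrite EFinD; apply: leeD.
    apply: le_trans (IHs kap); rewrite lee_fin; apply: sign_avg_le => e.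
    rewrite le_eqVlt; apply/orP; left; apply/eqP; congr sup_on.
    by apply/funext => i; rewrite signed_sum_cons addrA.
  apply: le_trans (IHs (- kap)%R); rewrite lee_fin; apply: sign_avg_le => e.
  rewrite le_eqVlt; apply/orP; left; apply/eqP; congr sup_on.
  by apply/funext => i; rewrite signed_sum_cons addrA /c' mulNr.
have mHt := measurableT_comp mHE (@measurable_tcons _ (measurableTypeR R) n).
apply: ge0_le_integral => //.
- by move=> xi _; rewrite -EFinD -EFinM lee_fin mulr_ge0// addr_ge0.
- by apply: emeasurable_funM => //; exact: emeasurable_funD.
- by apply: (measurable_fun_fubini_tonelli_G (m1 := N) _ mHt) => w; rewrite lee_fin.
move=> xi _; rewrite -EFinD -EFinM mulrC.
have E s : H1 s xi = sup_on D (fun i =>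
    (c i + weighted_sum xi (v' i)) + s * v i ord0)%R.
  by congr sup_on; apply/funext => i; rewrite /c' addrAC.
have -> : (fun s => (sup_on D (fun i =>
    c i + weighted_sum (tcons (s, xi)) (v i))%R)%:E) =
    (fun s => (sup_on D (fun i =>
      (c i + weighted_sum xi (v' i)) + s * v i ord0)%R)%:E).
  by apply/funext => s; rewrite Hcons -E.
rewrite !E; apply: std_normal_jensen => //.
- by apply: bounded_onD => //; exact: bounded_on_weighted_sum.
- have -> : (fun s : R => sup_on D (fun i =>
      (c i + weighted_sum xi (v' i)) + s * v i ord0)%R) =
    (fun xi => sup_on D (fun i => c i + weighted_sum xi (v i))%R) \o
      (fun s => tcons (s, xi)).
    by apply/funext => s /=; rewrite Hcons -E.
  exact: (measurableT_comp mH (@measurable_tcons1 _ (measurableTypeR R) n xi)).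
by move=> s; rewrite -E.
Qed.

End gaussianization.

(** * Suprema over random convex sets *)

Section support_function.
Local Open Scope ring_scope.
Context (R : realType).

Lemma sup_on_gt I (D : set I) (f : I -> R) a : D !=set0 ->
  a < sup_on D f -> exists2 i, D i & a < f i.
Proof.
move=> D0 af; apply: contrapT => H; move: af; apply/negP; rewrite -leNgt.
apply: sup_on_le => // i Di; rewrite leNgt; apply/negP => afi.
by apply: H; exists i.
Qed.

Definition dot n (p v : 'I_n -> R) : R := \sum_(j < n) p j * v j.

Definition dist2 n (q v : 'I_n -> R) : R := \sum_(j < n) (q j - v j) ^+ 2.

Definition ffun_ratr n (p : {ffun 'I_n -> rat}) : 'I_n -> R := fun j => ratr (p j).

Lemma ffun_ratr_dense n (v : 'I_n -> R) eps : 0 < eps ->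
  exists p, forall j, `|ffun_ratr p j - v j| < eps.
Proof.
move=> eps0; have /choice [p pv] : forall j, exists r : rat,
    `|ratr r - v j| < eps.
  move=> j; have [r] : exists r, ratr r \in `](v j - eps), (v j + eps)[.
    by apply: rat_in_itvoo; lra.
  by rewrite in_itv /= => /andP[? ?]; exists r; rewrite ltr_norml; lra.
by exists [ffun j => p j] => j; rewrite /ffun_ratr ffunE.
Qed.

Lemma bounded_on_dot I (D : set I) n (V : I -> 'I_n -> R) B p :
  (forall i j, D i -> `|V i j| <= B) ->
  bounded_on_set D (fun i => dot p (V i)).
Proof.
move=> VB; apply: bounded_on_sum => j; apply: bounded_onZ.
by exists B => i Di; exact: VB.
Qed.

(** The dual objective for the squared distance from [q] to the convex set of the [V i]. The set
    enters only through its support function, the one quantity known to be measurable. *)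
Definition support_gap I (D : set I) n (V : I -> 'I_n -> R) (q p : 'I_n -> R) : R :=
  2 * dot p q - 2 * sup_on D (fun i => dot p (V i)) - \sum_(j < n) p j ^+ 2.

(** Weak duality: coordinate by coordinate, the difference is the square of q - V i - p. *)
Lemma support_gap_le_dist2 I (D : set I) n (V : I -> 'I_n -> R) B q p i :
  (forall i j, D i -> `|V i j| <= B) -> D i ->
  support_gap D V q p <= dist2 q (V i).
Proof.
move=> VB Di; have := sup_on_ub (bounded_on_dot p VB) Di.
rewrite /support_gap; set h := sup_on _ _ => hV.
apply: (@le_trans _ _ (2 * dot p q - 2 * dot p (V i) - \sum_(j < n) p j ^+ 2)).
  lra.
rewrite -subr_ge0 /dist2 /dot !mulr_sumr -!sumrB.
apply: sumr_ge0 => j _; have := sqr_ge0 (q j - V i j - p j); nra.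
Qed.

(* The squared distance from [q] to the closure of a convex set is the supremum
   of the support gap: a near-minimiser V i of the distance gives the almost
   optimal direction q - V i. *)
Lemma support_gap_gt I (D : set I) n (V : I -> 'I_n -> R) B q delta eps :
  D !=set0 -> (forall i j, D i -> `|V i j| <= B) ->
  (forall i i' s, D i -> D i' -> 0 <= s <= 1 ->
    exists2 k, D k & forall j, V k j = V i j + s * (V i' j - V i j)) ->
  (forall i, D i -> delta <= dist2 q (V i)) -> 0 < eps ->
  exists p, delta - eps < support_gap D V q (ffun_ratr p).
Proof.
move=> D0 VB Vcvx Vdist eps0.
have B0 : 0 <= B \/ n = 0%N.
  case: (n) V VB {Vcvx Vdist q} => [|m] V VB; [by right|left].
  by have [i Di] := D0; rewrite (le_trans _ (VB i ord0 Di)).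
have nB0 : 0 <= n%:R * B.
  by case: B0 => [B0|->]; rewrite ?mul0r// mulr_ge0.
pose Q := \sum_(j < n) `|q j|.
have Q0 : 0 <= Q by apply: sumr_ge0.
pose C := (1 + 4 * B * (n%:R * B)) / 2.
pose K := 2 * C + 4 * (n%:R * B) + 4 * Q + n%:R.
have BB0 : 0 <= B * (n%:R * B).
  by rewrite mulrCA mulr_ge0// -expr2 sqr_ge0.
have K0 : 0 <= K by rewrite /K /C; have := ler0n R n; lra.
(* [eta] is at once the step along segments and the accuracy of the rational direction, and its
   square is the slack allowed to the near-minimizer. The resulting errors add up to at most
   [eta * K]. *)
pose eta := Num.min 1 (eps / (2 * (K + 1))).
have eta0 : 0 < eta.
  by rewrite lt_min ltr01/= divr_gt0// mulr_gt0//; lra.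
have eta1 : eta <= 1 by rewrite ge_min lexx.
have etaK : eta * K < eps.
  apply: (@le_lt_trans _ _ (eps / (2 * (K + 1)) * K)).
    by rewrite ler_wpM2r// ge_min lexx orbT.
  rewrite mulrAC ltr_pdivrMr; last lra.
  by rewrite ltr_pM2l//; lra.
pose r := sup_on D (fun i => - dist2 q (V i)).
have bd : bounded_on_set D (fun i => - dist2 q (V i)).
  exists (\sum_(j < n) (`|q j| + B) ^+ 2) => i Di.
  rewrite normrN (le_trans (ler_norm_sum _ _ _))// ler_sum// => j _.
  rewrite normrX lerXn2r ?nnegrE//.
    by rewrite addr_ge0// (le_trans _ (VB i j Di)).
  by rewrite (le_trans (ler_normB _ _))// lerD2l VB.
have [i Di ri] : exists2 i, D i & r - eta ^+ 2 < - dist2 q (V i).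
  by apply: sup_on_gt => //; rewrite -/r ltrBlDr ltrDl exprn_gt0.
pose c j := q j - V i j.
(* Approximate first-order optimality: a step [eta] from V i towards V i' cannot lower the squared
   distance by more than [eta ^+ 2], so the direction c nearly supports the set at V i. *)
have cV i' : D i' -> dot c (V i') <= dot c (V i) + eta * C.
  move=> Di'; have [|k Dk Vk] := Vcvx i i' eta Di Di'; first by rewrite ltW.
  have := sup_on_ub bd Dk; rewrite -/r => kr.
  pose w j := V i' j - V i j.
  have : dist2 q (V k) = dist2 q (V i) - 2 * eta * dot c w +
      eta ^+ 2 * \sum_(j < n) w j ^+ 2.
    rewrite /dist2 /dot !mulr_sumr -sumrB -big_split /=.
    by apply: eq_bigr => j _; rewrite Vk /c /w; ring.
  have wB : \sum_(j < n) w j ^+ 2 <= 4 * B * (n%:R * B).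
    apply: (@le_trans _ _ (\sum_(j < n) (B + B) ^+ 2)).
      apply: ler_sum => j _; rewrite -[w j ^+ 2]real_normK ?num_real//.
      have Bj : 0 <= B by rewrite (le_trans _ (VB i j Di)).
      rewrite lerXn2r ?nnegrE ?addr_ge0//.
      by rewrite (le_trans (ler_normB _ _))// lerD ?VB.
    by rewrite sumr_const card_ord -mulr_natl; lra.
  have dcw : dot c w = dot c (V i') - dot c (V i).
    by rewrite /dot -sumrB; apply: eq_bigr => j _; rewrite /w mulrBr.
  rewrite -lerBlDl -dcw => E.
  have : eta ^+ 2 * (\sum_(j < n) w j ^+ 2) <= eta ^+ 2 * (4 * B * (n%:R * B)).
    by rewrite ler_wpM2l// sqr_ge0.
  move: E kr ri; set dk := dist2 q (V k); set di := dist2 q (V i) => E kr ri wB2.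
  have : 2 * eta * dot c w <= eta ^+ 2 * (2 * C) by rewrite /C; lra.
  rewrite expr2 -!mulrA mulrCA ler_pM2l// => h.
  by move: h; move: (dot c w) (C) => u z h; lra.
have [p pc] := ffun_ratr_dense c eta0.
exists p; set P := ffun_ratr p in pc *.
have cb j : `|c j| <= `|q j| + B.
  by rewrite (le_trans (ler_normB _ _))// lerD2l VB.
have hP : sup_on D (fun i => dot P (V i)) <=
    dot c (V i) + eta * C + eta * (n%:R * B).
  apply: sup_on_le => // i' Di'.
  have -> : dot P (V i') = dot c (V i') + \sum_(j < n) (P j - c j) * V i' j.
    by rewrite /dot -big_split/=; apply: eq_bigr => j _; ring.
  apply: lerD; first exact: cV.
  apply: (@le_trans _ _ (\sum_(j < n) eta * B)).
    apply: ler_sum => j _; rewrite (le_trans (ler_norm _))// normrM.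
    by rewrite ler_pM// ?VB// ltW.
  by rewrite sumr_const card_ord -mulr_natl; lra.
have PQ : dot c q - eta * Q <= dot P q.
  rewrite lerBlDr -lerBlDl /dot -sumrB /Q mulr_sumr.
  apply: ler_sum => j _; rewrite -mulrBl (le_trans (ler_norm _))// normrM.
  by rewrite ler_wpM2r// distrC ltW.
have P2 : \sum_(j < n) P j ^+ 2 <= \sum_(j < n) c j ^+ 2 +
    eta * (2 * Q + 2 * (n%:R * B) + n%:R).
  have -> : eta * (2 * Q + 2 * (n%:R * B) + n%:R) =
      \sum_(j < n) eta * (2 * `|q j| + 2 * B + 1).
    rewrite -mulr_sumr !big_split /= -mulr_sumr !sumr_const card_ord.
    by rewrite -/Q -(mulr_natl (2 * B)); ring.
  rewrite -big_split /=; apply: ler_sum => j _.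
  have -> : P j ^+ 2 = c j ^+ 2 + (P j - c j) * (2 * c j + (P j - c j)) by ring.
  rewrite lerD2l (le_trans (ler_norm _))// normrM ler_pM//; first exact: ltW.
  rewrite (le_trans (ler_normD _ _))// normrM (@ger0_norm _ 2)//.
  by have := pc j; have := cb j; lra.
have dcq : dot c q - dot c (V i) = dist2 q (V i).
  by rewrite /dot /dist2 -sumrB; apply: eq_bigr => j _; rewrite /c; ring.
have c2 : \sum_(j < n) c j ^+ 2 = dist2 q (V i) by [].
rewrite /support_gap.
have := Vdist i Di; move: etaK; rewrite /K.
by rewrite c2 in P2; lra.
Qed.

End support_function.

(** * Measurability of suprema over convex sets of random vectors *)

Section measurable_supremum.
Local Open Scope ring_scope.
Context d (X : measurableType d) (R : realType).

Lemma measurable_fun_gt (f : X -> R) :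
  (forall a, measurable [set x | a < f x]) -> measurable_fun [set: X] f.
Proof.
move=> H mD; apply: (measurability _ (RGenOInfty.measurableE R)) => //.
move=> /= _ [_ [a ->] <-]; rewrite setTI.
rewrite (_ : _ @^-1` _ = [set x | a < f x]); first exact: H.
by apply/seteqP; split=> x /=; rewrite in_itv/= andbT.
Qed.

Lemma measurable_lt_cst (f : X -> R) a : measurable_fun [set: X] f ->
  measurable [set x | a < f x].
Proof.
move=> mf; rewrite -[X in measurable X]setTI.
rewrite (_ : [set x | a < f x] = f @^-1` `]a, +oo[%classic).
  by apply: mf => //; exact: measurable_itv.
by apply/seteqP; split=> x /=; rewrite in_itv/= andbT.
Qed.

(* If K x is the closure of {V i x | i in D}, then a < sup phi(K x) holds iff
   some rational point q with phi q > a is close enough to K x, and the distance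
   from q to the convex set K x is determined by its support function. *)
Lemma measurable_sup_on_convex I (D : set I) n (V : I -> X -> 'I_n -> R) (B : R)
    (phi : ('I_n -> R) -> R) :
  D !=set0 -> (forall i x j, D i -> `|V i x j| <= B) ->
  (forall i i' s, D i -> D i' -> 0 <= s <= 1 -> exists2 k, D k &
    forall x j, V k x j = V i x j + s * (V i' x j - V i x j)) ->
  (forall p : 'I_n -> R,
    measurable_fun [set: X] (fun x => sup_on D (fun i => dot p (V i x)))) ->
  (forall v w : 'I_n -> R, `|phi v - phi w| <= \sum_(j < n) `|v j - w j|) ->
  measurable_fun [set: X] (fun x => sup_on D (fun i => phi (V i x))).
Proof.
move=> D0 VB Vcvx mV phiL.
pose dl k : R := k.+1%:R^-1.
have dl0 k : 0 < dl k by rewrite invr_gt0 ltr0n.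
have dl_small e : 0 < e -> exists k, dl k < e.
  move=> e0; have [k _ H] := near_infty_natSinv_lt (PosNum e0).
  by exists k; apply: (H k) => /=.
have bphi x : bounded_on_set D (fun i => phi (V i x)).
  exists (`|phi (fun=> 0)| + n%:R * B) => i Di.
  rewrite -[phi (V i x)](subrK (phi (fun=> 0))) addrC.
  rewrite (le_trans (ler_normD _ _))// lerD2l (le_trans (phiL _ _))//.
  apply: (@le_trans _ _ (\sum_(j < n) B)).
    by apply: ler_sum => j _; rewrite subr0 VB.
  by rewrite sumr_const card_ord mulr_natl.
pose near q k := [set x | exists2 i, D i & dist2 q (V i x) < dl k ^+ 2].
(* Strong and weak duality together: all points are at distance at least [dl k] from q iff, for
   every m, some rational direction has gap above [dl k ^+ 2 - dl m]. Only countably many support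
   functions are involved. *)
have nearE q k : near q k = ~` \bigcap_m \bigcup_(p : {ffun 'I_n -> rat})
    [set x | dl k ^+ 2 - dl m < support_gap D (V ^~ x) q (ffun_ratr R p)].
  apply/seteqP; split=> x.
  - move=> [i Di di] H.
    have [m dm] := dl_small (dl k ^+ 2 - dist2 q (V i x))
      ltac:(by rewrite subr_gt0).
    have [p _ /= pm] := H m Logic.I.
    have := support_gap_le_dist2 q (ffun_ratr R p) (fun i j => VB i x j) Di.
    by lra.
  - move=> H; apply: contrapT => Hn; apply: H => m _.
    have [|||p pm] := @support_gap_gt R I D n (V ^~ x) B q (dl k ^+ 2) (dl m)
      D0 (fun i j => VB i x j).
    + move=> i i' s Di Di' s01; have [k' Dk' Vk'] := Vcvx _ _ _ Di Di' s01.
      by exists k' => // j; exact: Vk'.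
    + by move=> i Di; rewrite leNgt; apply/negP => dq; apply: Hn; exists i.
    + exact: dl0.
    + by exists p.
have mnear q k : measurable (near q k).
  rewrite nearE; apply: measurableC; apply: bigcapT_measurable => m.
  apply: countable_bigcupT_measurable => [|p]; first exact: countableP.
  apply: measurable_lt_cst; apply: measurable_funB => //.
  apply: measurable_funB => //; exact: measurable_funM.
apply: measurable_fun_gt => a.
(* The margin [n%:R * dl k] pays for moving from q to a point within Euclidean distance [dl k],
   because [phi] is 1-Lipschitz for the l1 norm. *)
rewrite (_ : [set x | a < _] = \bigcup_(q : {ffun 'I_n -> rat}) \bigcup_k
    (if a + n%:R * dl k < phi (ffun_ratr R q) then near (ffun_ratr R q) k
     else set0)); last first.
  apply/seteqP; split=> x /=.
  - move=> /(sup_on_gt D0)[i Di ai].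
    have n1 : 0 < n.+1%:R :> R by rewrite ltr0n.
    have [k dk] := dl_small ((phi (V i x) - a) / n.+1%:R)
      ltac:(by rewrite divr_gt0// subr_gt0).
    rewrite ltr_pdivlMr// -natr1 mulrDr mulr1 in dk.
    have e0 : 0 < dl k / n.+1%:R by rewrite divr_gt0.
    have [q qV] := ffun_ratr_dense (V i x) e0.
    have nn1 : n%:R / n.+1%:R <= 1 :> R.
      by rewrite ler_pdivrMr// mul1r ler_nat.
    exists q => //; exists k => //.
    have -> : a + n%:R * dl k < phi (ffun_ratr R q).
      have := phiL (ffun_ratr R q) (V i x).
      have : \sum_(j < n) `|ffun_ratr R q j - V i x j| <= dl k.
        apply: (@le_trans _ _ (\sum_(j < n) dl k / n.+1%:R)).
          by apply: ler_sum => j _; rewrite ltW.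
        rewrite sumr_const card_ord -[_ *+ n]mulr_natl mulrCA.
        by rewrite ler_piMr// ltW.
      by move=> h1; rewrite ler_norml => /andP[h2 h3]; lra.
    exists i => //; rewrite /dist2.
    apply: (@le_lt_trans _ _ (\sum_(j < n) (dl k / n.+1%:R) ^+ 2)).
      apply: ler_sum => j _; rewrite -[X in X <= _]real_normK ?num_real//.
      by rewrite lerXn2r ?nnegrE// ltW.
    rewrite sumr_const card_ord -[_ *+ n]mulr_natl exprMn mulrCA.
    rewrite -[X in _ < X]mulr1 ltr_pM2l ?exprn_gt0//.
    rewrite exprVn ltr_pdivrMr ?exprn_gt0// mul1r -natrX ltr_nat.
    by rewrite expnS expn1 (leq_trans (ltnSn n))// leq_pmulr.
  - move=> [q _ [k _]]; case: ifP => // ak [i Di di].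
    apply: lt_le_trans (sup_on_ub (bphi x) Di).
    have := phiL (ffun_ratr R q) (V i x).
    have : \sum_(j < n) `|ffun_ratr R q j - V i x j| <= n%:R * dl k.
      apply: (@le_trans _ _ (\sum_(j < n) dl k)); last first.
        by rewrite sumr_const card_ord mulr_natl.
      apply: ler_sum => j _; rewrite -(@ler_pXn2r _ 2) ?nnegrE// ?ltW//.
      rewrite real_normK ?num_real//; apply: le_lt_trans di.
      rewrite /dist2 (bigD1 j)//= lerDl; apply: sumr_ge0 => l _.
      exact: sqr_ge0.
    by move=> h1; rewrite ler_norml => /andP[h2 h3]; lra.
apply: countable_bigcupT_measurable => [|q]; first exact: countableP.
by apply: bigcupT_measurable => k; case: ifP.
Qed.

End measurable_supremum.

(** * Centered Gaussian suprema *)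

Section centered_supremum.
Context d (T : measurableType d) (R : realType).
Implicit Types (F G : set (T -> R)) (f : T -> R).
Local Notation N := (std_normal R).
Local Notation kap := (std_normal_abs_mean R).

Lemma power_normal_coord_integrable n (i : 'I_n) :
  (power_prob N n).-integrable [set: n.-tuple (measurableTypeR R)]
    (fun xi => (tnth xi i)%:E).
Proof.
have mi : measurable_fun [set: n.-tuple (measurableTypeR R)]
    (fun xi : n.-tuple (measurableTypeR R) => (tnth xi i)%:E : \bar R).
  by apply/measurable_EFinP; exact: measurable_tnth.
apply/integrableP; split => //.
rewrite (integral_power_prob_tnth N i (g := fun s : measurableTypeR R => `|s%:E|)).
- by rewrite [X in X < _](std_normal_abs_meanE R) ltry.
- exact: measurable_abs_EFin.
- by move=> s; exact: abse_ge0.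
Qed.

(** By symmetry of the normal law the positive and negative parts have the same integral, which is
    finite because E|s| is. *)
Lemma power_normal_coord_mean n (i : 'I_n) :
  \int[power_prob N n]_xi (tnth xi i)%:E = 0.
Proof.
have mid : measurable_fun [set: measurableTypeR R]
  (EFin : measurableTypeR R -> \bar R) by exact/measurable_EFinP.
have mp : measurable_fun [set: measurableTypeR R]
  ((EFin : measurableTypeR R -> \bar R)^\+) by exact: measurable_funepos.
have mn : measurable_fun [set: measurableTypeR R]
  ((EFin : measurableTypeR R -> \bar R)^\-) by exact: measurable_funeneg.
rewrite integralE.
have -> : (fun xi : n.-tuple (measurableTypeR R) => (tnth xi i)%:E : \bar R)^\+ =
  fun xi => (EFin : measurableTypeR R -> \bar R)^\+ (tnth xi i).
  by apply/funext => xi; rewrite !(funeposE, funenegE).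
have -> : (fun xi : n.-tuple (measurableTypeR R) => (tnth xi i)%:E : \bar R)^\- =
  fun xi => (EFin : measurableTypeR R -> \bar R)^\- (tnth xi i).
  by apply/funext => xi; rewrite !(funeposE, funenegE).
rewrite !integral_power_prob_tnth//.
have -> : \int[N]_s (EFin : measurableTypeR R -> \bar R)^\- s =
    \int[N]_s (EFin : measurableTypeR R -> \bar R)^\+ s.
  rewrite -(std_normal_integralN mp)//.
  by apply: eq_integral => s _; rewrite funeposE funenegE EFinN.
apply: subee; rewrite ge0_fin_numE; last by apply: integral_ge0.
apply: (@le_lt_trans _ _ (\int[N]_s `|s|%:E)).
  apply: ge0_le_integral => //; first exact: measurable_abs_EFin.
  by move=> s _; rewrite funeposE ge_max !lee_fin ler_norm normr_ge0.
by rewrite std_normal_abs_meanE ltry.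
Qed.

Lemma weighted_sum_integrable n (v : 'I_n -> R) :
  (power_prob N n).-integrable [set: n.-tuple (measurableTypeR R)]
    (fun xi => (weighted_sum xi v)%:E).
Proof.
rewrite (_ : (fun xi => _) = fun xi : n.-tuple (measurableTypeR R) =>
    \sum_(i < n) (v i)%:E * (tnth xi i)%:E).
  apply: integrable_sum => // i _; apply: integrableZl => //.
  exact: power_normal_coord_integrable.
apply/funext => xi; rewrite /weighted_sum -sumEFin; apply: eq_bigr => i _.
by rewrite mulrC.
Qed.

Lemma weighted_sum_mean n (v : 'I_n -> R) :
  \int[power_prob N n]_xi (weighted_sum xi v)%:E = 0.
Proof.
transitivity (\int[power_prob N n]_xi \sum_(i < n) (v i)%:E * (tnth xi i)%:E).
  apply: eq_integral => xi _; rewrite /weighted_sum -sumEFin.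
  by apply: eq_bigr => i _; rewrite mulrC.
rewrite integral_sum//; last first.
  by move=> i; apply: integrableZl => //; exact: power_normal_coord_integrable.
rewrite big1// => i _; rewrite integralZl//.
  by rewrite power_normal_coord_mean mule0.
exact: power_normal_coord_integrable.
Qed.

Definition scaled_dev f0 n (x : n.-tuple T) f : 'I_n -> R :=
  fun i => (n%:R^-1 * (f (tnth x i) - f0 (tnth x i)))%R.

(** The differences from f0 make this supremum nonnegative as soon as f0 lies in [G], while its
    Gaussian mean stays that of the uncentered one. *)
Definition centered_sup f0 G n (x : n.-tuple T) (xi : n.-tuple R) : R :=
  sup_on G (fun f => weighted_sum xi (scaled_dev f0 x f)).

Variable F : set (T -> R).
Hypothesis F1 : forall f, F f -> forall z, (- 1 <= f z <= 1)%R.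
Variable f0 : T -> R.
Hypothesis Ff0 : F f0.

Lemma scaled_dev_le n (x : n.-tuple T) f i : F f ->
  (`|scaled_dev f0 x f i| <= 2 / n%:R)%R.
Proof.
move=> Ff; rewrite /scaled_dev normrM ger0_norm ?invr_ge0// mulrC.
rewrite ler_wpM2r ?invr_ge0// ler_norml.
by have := F1 Ff (tnth x i); have := F1 Ff0 (tnth x i); lra.
Qed.

Lemma bounded_scaled_dev G n (x : n.-tuple T) i : G `<=` F ->
  bounded_on_set G (fun f => scaled_dev f0 x f i).
Proof. by move=> GF; exists (2 / n%:R)%R => f /GF; exact: scaled_dev_le. Qed.

Lemma bounded_centered_sup G n (x : n.-tuple T) (xi : n.-tuple R) : G `<=` F ->
  bounded_on_set G (fun f => weighted_sum xi (scaled_dev f0 x f)).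
Proof.
by move=> GF; apply: bounded_on_weighted_sum => j; exact: bounded_scaled_dev.
Qed.

Lemma weighted_sum_scaled_dev0 n (x : n.-tuple T) (xi : n.-tuple R) :
  weighted_sum xi (scaled_dev f0 x f0) = 0%R.
Proof.
by rewrite /weighted_sum big1// => i _; rewrite /scaled_dev subrr !mulr0.
Qed.

Lemma centered_sup_ge0 G n (x : n.-tuple T) (xi : n.-tuple R) :
  G `<=` F -> G f0 -> (0 <= centered_sup f0 G x xi)%R.
Proof.
move=> GF Gf0; rewrite -(weighted_sum_scaled_dev0 x xi).
exact: (sup_on_ub (bounded_centered_sup x xi GF) Gf0).
Qed.

Lemma centered_sup_subset G G' n (x : n.-tuple T) (xi : n.-tuple R) :
  G `<=` G' -> G' `<=` F -> G f0 ->
  (centered_sup f0 G x xi <= centered_sup f0 G' x xi)%R.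
Proof.
move=> GG' GF Gf0; apply: sup_on_le; first by exists f0.
move=> f Gf; apply: (sup_on_ub (bounded_centered_sup x xi GF)); exact: GG'.
Qed.

Lemma centered_sup_le G n (x : n.-tuple T) (xi : n.-tuple R) :
  G `<=` F -> G f0 ->
  (centered_sup f0 G x xi <= \sum_(i < n) 2 / n%:R * `|tnth xi i|)%R.
Proof.
move=> GF Gf0; apply: sup_on_le; first by exists f0.
move=> f /GF Ff; rewrite /weighted_sum ler_sum// => i _.
rewrite (le_trans (ler_norm _))// normrM mulrC ler_wpM2r//.
exact: scaled_dev_le.
Qed.

Lemma gaussian_supE G n (x : n.-tuple T) (xi : n.-tuple R) :
  G `<=` F -> G f0 ->
  gaussian_sup G x xi = (centered_sup f0 G x xi +
    weighted_sum xi (fun i => n%:R^-1 * f0 (tnth x i)))%:E.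
Proof.
move=> GF Gf0.
have E f : (n%:R^-1 * \sum_(i < n) tnth xi i * f (tnth x i))%R =
    (weighted_sum xi (scaled_dev f0 x f) +
     weighted_sum xi (fun i => n%:R^-1 * f0 (tnth x i)))%R.
  rewrite /weighted_sum -big_split /= mulr_sumr.
  by apply: eq_bigr => i _; rewrite /scaled_dev; ring.
apply/eqP; rewrite eq_le; apply/andP; split.
  apply: ge_ereal_sup => _ [f Gf <-]; rewrite lee_fin E lerD2r.
  exact: (sup_on_ub (bounded_centered_sup x xi GF) Gf).
rewrite EFinD -leeBrDr//.
have H f : G f -> (weighted_sum xi (scaled_dev f0 x f) +
    weighted_sum xi (fun i => n%:R^-1 * f0 (tnth x i)))%:E <= gaussian_sup G x xi.
  by move=> Gf; rewrite -E; apply: ereal_sup_ubound; exists f.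
case: (gaussian_sup G x xi) H => [y| |] H; last 2 first.
- by rewrite leey.
- by have := H _ Gf0; rewrite leeNy_eq.
rewrite -EFinB lee_fin; apply: sup_on_le; first by exists f0.
by move=> f Gf; have := H f Gf; rewrite lee_fin lerBrDr.
Qed.

Section measurability.
Variables (n : nat) (G : n.-tuple T -> set (T -> R)).
Hypothesis GF : forall x, G x `<=` F.
Hypothesis Gf0 : forall x, G x f0.
Hypothesis Fm : forall f, F f -> measurable_fun [set: T] f.
Hypothesis mG : measurable_fun [set: n.-tuple T * n.-tuple (measurableTypeR R)]
  (fun w => gaussian_sup (G w.1) w.1 w.2).

Lemma measurable_centered_sup :
  measurable_fun [set: n.-tuple T * n.-tuple (measurableTypeR R)]
    (fun w => centered_sup f0 (G w.1) w.1 w.2).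
Proof.
have ml : measurable_fun [set: n.-tuple T * n.-tuple (measurableTypeR R)]
    (fun w => weighted_sum w.2 (fun i => n%:R^-1 * f0 (tnth w.1 i))%R).
  apply: measurable_sum => i; apply: measurable_funM.
    exact: (measurableT_comp (measurable_tnth i) measurable_snd).
  apply: measurable_funM => //; apply: (measurableT_comp (Fm Ff0)).
  exact: (measurableT_comp (measurable_tnth i) measurable_fst).
have -> : (fun w : n.-tuple T * n.-tuple (measurableTypeR R) =>
    centered_sup f0 (G w.1) w.1 w.2) = fun w =>
    (fine (gaussian_sup (G w.1) w.1 w.2) -
     weighted_sum w.2 (fun i => n%:R^-1 * f0 (tnth w.1 i)))%R.
  by apply/funext => w; rewrite gaussian_supE// /= addrK.
by apply: measurable_funB => //; exact: measurableT_comp.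
Qed.

Lemma measurable_centered_supE :
  measurable_fun [set: n.-tuple T * n.-tuple (measurableTypeR R)]
    (fun w => (centered_sup f0 (G w.1) w.1 w.2)%:E : \bar R).
Proof. by apply/measurable_EFinP; exact: measurable_centered_sup. Qed.

(** Centering removes a term linear in the noise, of mean zero. Splitting the integral requires
    integrability of the supremum, which is dominated by a multiple of the sum of the |xi_i|. *)
Lemma emp_gaussian_avgE (x : n.-tuple T) :
  emp_gaussian_avg (G x) x =
  \int[power_prob N n]_xi (centered_sup f0 (G x) x xi)%:E.
Proof.
have ms : measurable_fun [set: n.-tuple (measurableTypeR R)]
    (fun xi => (centered_sup f0 (G x) x xi)%:E : \bar R).
  exact: (measurableT_comp measurable_centered_supE (pair1_measurable x)).
rewrite /emp_gaussian_avg.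
under eq_integral do rewrite gaussian_supE// EFinD.
rewrite integralD//.
- by rewrite weighted_sum_mean adde0.
- have ig : (power_prob N n).-integrable [set: n.-tuple (measurableTypeR R)]
      (fun xi => \sum_(i < n) (2 / n%:R)%R%:E * `|(tnth xi i)%:E|).
    apply: integrable_sum => // i _; apply: integrableZl => //.
    by apply: integrable_abse; exact: power_normal_coord_integrable.
  apply: (le_integrable _ ms _ ig) => // xi _.
  rewrite gee0_abs ?lee_fin ?centered_sup_ge0//.
  apply: le_trans (lee_abs _).
  apply: (@le_trans _ _ (\sum_(i < n) 2 / n%:R * `|tnth xi i|)%R%:E).
    by rewrite lee_fin centered_sup_le.
  by rewrite -sumEFin.
- exact: weighted_sum_integrable.
Qed.

Lemma gaussian_avgE (P : probability T R) :
  gaussian_avg P G =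
  \int[power_prob P n]_x \int[power_prob N n]_xi
    (centered_sup f0 (G x) x xi)%:E.
Proof. by apply: eq_integral => x _; exact: emp_gaussian_avgE. Qed.

End measurability.

End centered_supremum.

(** * Second moment of the centered supremum over the class *)

Section moments.
Context d (T : measurableType d) (R : realType).
Local Notation N := (std_normal R).
Local Notation kap := (std_normal_abs_mean R).

Definition std_normal_sqr_mean : R := fine (\int[N]_s (s ^+ 2)%:E).
Local Notation m2 := std_normal_sqr_mean.

Lemma std_normal_sqr_meanE : \int[N]_s (s ^+ 2)%:E = m2%:E.
Proof.
rewrite fineK// ge0_fin_numE ?std_normal_sqr_lty//.
by apply: integral_ge0 => s _; rewrite lee_fin sqr_ge0.
Qed.

Lemma std_normal_sqr_mean_ge0 : (0 <= m2)%R.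
Proof.
rewrite -lee_fin -std_normal_sqr_meanE.
by apply: integral_ge0 => s _; rewrite lee_fin sqr_ge0.
Qed.

Lemma sup_on_dist I (D : set I) (f g : I -> R) e : D !=set0 ->
  bounded_on_set D f -> bounded_on_set D g ->
  (forall i, D i -> (`|f i - g i| <= e)%R) ->
  (`|sup_on D f - sup_on D g| <= e)%R.
Proof.
move=> D0 bf bg fg; rewrite ler_distl; apply/andP; split.
  rewrite lerBlDr; apply: sup_on_le => // i Di.
  have := sup_on_ub bf Di; have := fg i Di.
  by rewrite ler_norml => /andP[]; lra.
apply: sup_on_le => // i Di.
have := sup_on_ub bg Di; have := fg i Di.
by rewrite ler_norml => /andP[]; lra.
Qed.

Variables (P : probability T R) (F : set (T -> R)) (f0 : T -> R) (n : nat).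
Hypothesis Fm : forall f, F f -> measurable_fun [set: T] f.
Hypothesis F1 : forall f, F f -> forall z, (- 1 <= f z <= 1)%R.
Hypothesis Ff0 : F f0.
Hypothesis n0 : (0 < n)%N.
Hypothesis mF : measurable_fun [set: n.-tuple T * n.-tuple (measurableTypeR R)]
  (fun w => gaussian_sup F w.1 w.2).

Let F0 : F !=set0. Proof. by exists f0. Qed.
Let FF : F `<=` F. Proof. exact: subset_refl. Qed.
Let n0R : (0 < n%:R :> R)%R. Proof. by rewrite ltr0n. Qed.

Let Z (x : n.-tuple T) (xi : n.-tuple R) := centered_sup f0 F x xi.
Let Z0 x xi : (0 <= Z x xi)%R. Proof. exact: (centered_sup_ge0 F1). Qed.

Let mZ : measurable_fun [set: n.-tuple T * n.-tuple (measurableTypeR R)]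
  (fun w => Z w.1 w.2).
Proof.
exact: (@measurable_centered_sup _ _ _ F F1 f0 Ff0 n (fun=> F) (fun=> FF)
  (fun=> Ff0) Fm mF).
Qed.

Let mZx x : measurable_fun [set: n.-tuple (measurableTypeR R)] (Z x).
Proof. exact: (measurableT_comp mZ (pair1_measurable x)). Qed.

Let mZxE x : measurable_fun [set: n.-tuple (measurableTypeR R)]
  (fun xi => (Z x xi)%:E : \bar R).
Proof. by apply/measurable_EFinP; exact: mZx. Qed.

Let mabs (a : R) i : measurable_fun [set: n.-tuple (measurableTypeR R)]
  (fun xi : n.-tuple (measurableTypeR R) => a%:E * `|tnth xi i|%:E : \bar R).
Proof.
apply: emeasurable_funM => //; apply/measurable_EFinP.
exact: (measurableT_comp (@normr_measurable R setT) (measurable_tnth i)).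
Qed.

Let int_abs (a : R) i : (0 <= a)%R ->
  \int[power_prob N n]_xi (a%:E * `|tnth xi i|%:E) = (a * kap)%:E.
Proof.
move=> a0; rewrite ge0_integralZl_EFin//; last first.
  apply/measurable_EFinP.
  exact: (measurableT_comp (@normr_measurable R setT) (measurable_tnth i)).
rewrite (integral_power_prob_tnth N i (g := fun s : measurableTypeR R => `|s|%:E)).
- by rewrite std_normal_abs_meanE.
- exact: measurable_abs_EFin.
- by move=> s; rewrite lee_fin.
Qed.

(** Efron-Stein in the noise with reference value 0: setting xi_i to 0 moves the supremum by at most
    2|xi_i|/n, so n coordinates contribute n (2/n)^2 E xi^2. *)
Lemma noise_moments x : exists2 M : R,
  \int[power_prob N n]_xi (Z x xi)%:E = M%:E &
  \int[power_prob N n]_xi (Z x xi ^+ 2)%:E <= (M ^+ 2 + 4 * m2 / n%:R)%:E.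
Proof.
pose G (s : measurableTypeR R) : R := (2 / n%:R * `|s|)%R.
have G0 s : (0 <= G s)%R by rewrite mulr_ge0// divr_ge0.
have mG : measurable_fun [set: measurableTypeR R] G.
  by apply: measurable_funM => //; exact: normr_measurable.
have vG : \int[N]_s (G s ^+ 2)%:E <= ((2 / n%:R) ^+ 2 * m2)%:E.
  rewrite EFinM -std_normal_sqr_meanE -ge0_integralZl_EFin ?sqr_ge0//.
  - rewrite le_eqVlt; apply/orP; left; apply/eqP; apply: eq_integral => s _.
    by rewrite -EFinM /G exprMn real_normK ?num_real.
  - by move=> s _; rewrite lee_fin sqr_ge0.
  - exact: measurable_sqr_EFin.
have [||M h1 h2] := @efron_stein _ (measurableTypeR R) R N G 0%R _ mG G0 vG
    n (Z x) 0%R (mZx x) (Z0 x).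
- move=> xi; rewrite add0r; exact: (centered_sup_le F1).
- move=> i xi xi' xixi' xi'0; apply: sup_on_dist => //.
  + exact: (bounded_centered_sup F1).
  + exact: (bounded_centered_sup F1).
  move=> f Ff; rewrite /weighted_sum -sumrB (bigD1 i)//= big1 ?addr0; last first.
    by move=> j ji; rewrite xixi'// subrr.
  rewrite xi'0 mul0r subr0 normrM mulrC /G ler_wpM2r//.
  exact: (scaled_dev_le F1).
exists M => //; apply: (le_trans h2); rewrite lee_fin.
by rewrite le_eqVlt; apply/orP; left; apply/eqP; field; rewrite gt_eqF.
Qed.

Definition noise_mean (x : n.-tuple T) : R :=
  fine (\int[power_prob N n]_xi (Z x xi)%:E).

Lemma noise_meanE x : \int[power_prob N n]_xi (Z x xi)%:E = (noise_mean x)%:E.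
Proof. by rewrite /noise_mean; have [M -> _] := noise_moments x. Qed.

Let M0 x : (0 <= noise_mean x)%R.
Proof.
by rewrite -lee_fin -noise_meanE; apply: integral_ge0 => xi _; rewrite lee_fin.
Qed.

Let mM : measurable_fun [set: n.-tuple T] noise_mean.
Proof.
apply/measurable_EFinP.
have mZE : measurable_fun [set: n.-tuple T * n.-tuple (measurableTypeR R)]
  (fun w => (Z w.1 w.2)%:E : \bar R) by exact/measurable_EFinP.
rewrite (_ : EFin \o _ = fubini_F (power_prob N n) (fun w => (Z w.1 w.2)%:E)).
  by apply: measurable_fun_fubini_tonelli_F => // w; rewrite lee_fin.
by apply/funext => x; rewrite /fubini_F /= noise_meanE.
Qed.

(** A new i-th design point changes only the i-th deviation, by at most 4/n as each deviation is at
    most 2/n in absolute value. *)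
Let noise_mean_coord i (x x' : n.-tuple T) :
  (forall j, j != i -> tnth x j = tnth x' j) ->
  (noise_mean x <= noise_mean x' + 4 / n%:R * kap)%R.
Proof.
move=> xx'; have c0 : (0 <= 4 / n%:R :> R)%R by rewrite divr_ge0.
rewrite -lee_fin EFinD -(int_abs i c0) -!noise_meanE -ge0_integralD//;
  try by move=> xi _; rewrite ?lee_fin// -EFinM lee_fin mulr_ge0.
apply: ge0_le_integral => //.
- by move=> xi _; rewrite lee_fin.
- by apply: emeasurable_funD; [exact: mZxE|exact: mabs].
move=> xi _; rewrite -EFinM -EFinD lee_fin.
apply: sup_on_le => // f Ff.
have := sup_on_ub (bounded_centered_sup F1 Ff0 x' xi FF) Ff; rewrite -/(centered_sup _ _ _ _).
suff : (weighted_sum xi (scaled_dev f0 x f) <=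
  weighted_sum xi (scaled_dev f0 x' f) + 4 / n%:R * `|tnth xi i|)%R.
  by rewrite /Z /centered_sup; lra.
rewrite -lerBlDl /weighted_sum -sumrB (bigD1 i)//= big1 ?addr0; last first.
  by move=> j ji; rewrite /scaled_dev xx'// subrr.
rewrite -mulrBr (le_trans (ler_norm _))// normrM mulrC ler_wpM2r//.
rewrite (le_trans (ler_normB _ _))//.
apply: (@le_trans _ _ (2 / n%:R + 2 / n%:R)%R); last by lra.
by rewrite lerD//; exact: (scaled_dev_le F1).
Qed.

(** Efron-Stein is applied twice: given the design it bounds the noise variance by 4 E xi^2 / n, and
    for the conditional mean as a function of the design it adds 16 [kap]^2 / n. In the second use
    [G] is constant, so any reference point serves. *)
Lemma centered_sup_moments : exists W : R,
  [/\ (0 <= W)%R,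
   \int[power_prob P n]_x \int[power_prob N n]_xi (Z x xi)%:E = W%:E &
   \int[power_prob P n]_x \int[power_prob N n]_xi (Z x xi ^+ 2)%:E <=
     (W ^+ 2 + (4 * m2 + 16 * kap ^+ 2) / n%:R)%:E].
Proof.
have kap0 := std_normal_abs_mean_gt0 R.
pose G := cst (4 / n%:R * kap)%R : T -> R.
have G0 s : (0 <= G s)%R by rewrite /G /= mulr_ge0 ?ltW// divr_gt0.
have vG : \int[P]_s (G s ^+ 2)%:E <= ((4 / n%:R * kap) ^+ 2)%:E.
  by rewrite -[leRHS](integral_prob_cst P) lexx.
have [||W h1 h2] := @efron_stein _ T R P G point _ (measurable_cst _) G0 vG
    n noise_mean (2 * kap)%R mM M0.
- move=> x; apply: (@le_trans _ _ (2 * kap)%R); last by rewrite lerDl sumr_ge0.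
  rewrite -lee_fin -noise_meanE.
  apply: (@le_trans _ _ (\int[power_prob N n]_xi
      (\sum_(i < n) (2 / n%:R)%R%:E * `|tnth xi i|%:E))).
    apply: ge0_le_integral => //.
    + by move=> xi _; rewrite lee_fin.
    + by apply: emeasurable_sum => i; exact: mabs.
    move=> xi _; rewrite sumEFin lee_fin; exact: (centered_sup_le F1).
  rewrite ge0_integral_sum//.
  under eq_bigr do rewrite int_abs ?divr_ge0//.
  rewrite sumEFin lee_fin sumr_const card_ord -[(_ *+ n)%R]mulr_natl.
  by rewrite le_eqVlt; apply/orP; left; apply/eqP; field; rewrite gt_eqF.
- move=> i x x' xx' _; rewrite ler_norml /G /=.
  have H1 := noise_mean_coord xx'.
  have H2 := @noise_mean_coord i x' x (fun j ji => esym (xx' j ji)).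
  by apply/andP; split; lra.
exists W; split.
- by rewrite -lee_fin -h1; apply: integral_ge0 => x _; rewrite lee_fin.
- by rewrite -h1; apply: eq_integral => x _; rewrite noise_meanE.
have mM2 : measurable_fun [set: n.-tuple T] (fun x => (noise_mean x ^+ 2)%:E : \bar R).
  by apply/measurable_EFinP; exact: measurable_funX.
have a0 : (0 <= 4 * m2 / n%:R)%R.
  by rewrite divr_ge0// mulr_ge0// std_normal_sqr_mean_ge0.
apply: (@le_trans _ _ (\int[power_prob P n]_x
    ((noise_mean x ^+ 2)%:E + (4 * m2 / n%:R)%:E))).
  apply: ge0_le_integral => //.
  - by move=> x _; apply: integral_ge0 => xi _; rewrite lee_fin sqr_ge0.
  - apply: (measurable_fun_fubini_tonelli_F (m2 := power_prob N n)
      (fun w => (Z w.1 w.2 ^+ 2)%:E)) => //.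
      by apply/measurable_EFinP; exact: measurable_funX.
    by move=> w; rewrite lee_fin sqr_ge0.
  - exact: emeasurable_funD.
  move=> x _; have [M h h'] := noise_moments x.
  by rewrite -EFinD (le_trans h')// lee_fin /noise_mean h.
rewrite ge0_integralD//; last by move=> x _; rewrite lee_fin sqr_ge0.
rewrite integral_prob_cst; apply: (le_trans (leeD2r _ h2)).
rewrite -EFinD lee_fin.
by rewrite le_eqVlt; apply/orP; left; apply/eqP; field; rewrite gt_eqF.
Qed.

End moments.

(** * A lower bound of order 1/n for the squared Gaussian average of the class *)

Section gaussian_lower_bound.
Context d (T : measurableType d) (R : realType).
Local Notation N := (std_normal R).
Local Notation kap := (std_normal_abs_mean R).

Lemma sign_avg_le_gaussian0 I (D : set I) n (v : I -> 'I_n -> R)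
    (H := fun xi : n.-tuple R => sup_on D (fun i => weighted_sum xi (v i))) :
  D !=set0 -> (forall j, bounded_on_set D (v^~ j)) ->
  measurable_fun [set: n.-tuple (measurableTypeR R)] H ->
  (forall xi, (0 <= H xi)%R) ->
  (sign_avg n (fun e =>
    sup_on D (fun i => signed_sum e (fun j => kap * v i j)%R)))%:E <=
  \int[power_prob N n]_xi (H xi)%:E.
Proof.
move=> D0 bv mH H0.
have E xi : H xi = sup_on D (fun i => 0 + weighted_sum xi (v i))%R.
  by congr sup_on; apply/funext => i; rewrite add0r.
have -> : (fun e => sup_on D (fun i => signed_sum e (fun j => kap * v i j)%R)) =
  (fun e => sup_on D (fun i => 0 + signed_sum e (fun j => kap * v i j))%R).
  by apply/funext => e; congr sup_on; apply/funext => i; rewrite add0r.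
under eq_integral do rewrite E.
have /funext HE := E.
apply: sign_avg_le_gaussian => //; first exact: bounded_on_cst.
  by rewrite -[X in measurable_fun _ X]HE.
by move=> xi; rewrite -E.
Qed.

Lemma signed_sumZ e n a (v : 'I_n -> R) :
  signed_sum e (fun j => a * v j)%R = (a * signed_sum e v)%R.
Proof. by rewrite /signed_sum mulr_sumr; apply: eq_bigr => j _; ring. Qed.

Lemma signed_sumD e n (v w : 'I_n -> R) :
  signed_sum e (fun j => v j + w j)%R = (signed_sum e v + signed_sum e w)%R.
Proof.
by rewrite /signed_sum -big_split/=; apply: eq_bigr => j _; rewrite mulrDr.
Qed.

Lemma sign_avg_signed_sum n s (v : 'I_n -> R) :
  sign_avg n (fun e => s + signed_sum e v)%R = s.
Proof.
elim: n s v => [|n IH] s v; first by rewrite /= /signed_sum big_ord0 addr0.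
have E b : sign_avg n (fun e => s + signed_sum (b :: e) v)%R =
    sign_avg n (fun e => (s + (if b then v ord0 else - v ord0)) +
      signed_sum e (fun j => v (lift ord0 j)))%R.
  by apply: sign_avg_eq => e; rewrite signed_sum_cons addrA.
by rewrite /= (E true) (E false) !IH; field.
Qed.

Variables (P : probability T R) (F : set (T -> R)) (f0 : T -> R) (n : nat).
Hypothesis Fm : forall f, F f -> measurable_fun [set: T] f.
Hypothesis F1 : forall f, F f -> forall z, (- 1 <= f z <= 1)%R.
Hypothesis Ff0 : F f0.
Hypothesis n0 : (0 < n)%N.
Hypothesis mF : measurable_fun [set: n.-tuple T * n.-tuple (measurableTypeR R)]
  (fun w => gaussian_sup F w.1 w.2).

Let n0R : (0 < n%:R :> R)%R. Proof. by rewrite ltr0n. Qed.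
Let FF : F `<=` F. Proof. exact: subset_refl. Qed.
Let F0 : F !=set0. Proof. by exists f0. Qed.

Let mZ : measurable_fun [set: n.-tuple T * n.-tuple (measurableTypeR R)]
  (fun w => centered_sup f0 F w.1 w.2).
Proof.
exact: (@measurable_centered_sup _ _ _ F F1 f0 Ff0 n (fun=> F) (fun=> FF)
  (fun=> Ff0) Fm mF).
Qed.

(** The smallest [r] allowed by [khintchine_lower] for every design: as |f1 - f2| <= 2, the sum of
    squares is at most 4 [kap]^2 / n, and 3 times this equals 2 [radius]^2. *)
Let radius : R := (kap * Num.sqrt (6 / n%:R))%R.

Let radius_gt0 : (0 < radius)%R.
Proof.
by rewrite mulr_gt0 ?std_normal_abs_mean_gt0// sqrtr_gt0 divr_gt0.
Qed.

Let radius2 : (radius ^+ 2 = 6 * kap ^+ 2 / n%:R)%R.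
Proof. by rewrite exprMn sqr_sqrtr ?divr_ge0// mulrCA mulrA. Qed.

(** The supremum over F dominates the maximum over f1 and f2, which is half the sum plus half the
    absolute difference of the two signed sums. The first part averages to zero, and Khintchine
    bounds the second. *)
Lemma noise_mean_ge (x : n.-tuple T) f1 f2 : F f1 -> F f2 ->
  ((kap / n%:R) ^+ 2 / (4 * radius) *
    \sum_(i < n) (f1 (tnth x i) - f2 (tnth x i)) ^+ 2)%:E <=
  \int[power_prob N n]_xi (centered_sup f0 F x xi)%:E.
Proof.
move=> Ff1 Ff2.
pose a f j := (kap * scaled_dev f0 x f j)%R.
have bdev j : bounded_on_set F (fun f => scaled_dev f0 x f j).
  exact: (bounded_scaled_dev F1).
apply: le_trans (sign_avg_le_gaussian0 F0 bdev _ _); last 2 first.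
- exact: (measurableT_comp mZ (pair1_measurable x)).
- by move=> xi; exact: (centered_sup_ge0 F1).
rewrite lee_fin.
pose b j := (kap / n%:R * (f1 (tnth x j) - f2 (tnth x j)))%R.
have aE j : (a f1 j + -1 * a f2 j = b j)%R.
  by rewrite /a /b /scaled_dev; ring.
apply: (@le_trans _ _ (sign_avg n (fun e =>
    2^-1 * (0 + signed_sum e (fun j => a f1 j + a f2 j)) +
    2^-1 * `|signed_sum e b|)%R)).
  rewrite sign_avgD !sign_avgZ sign_avg_signed_sum mulr0 add0r.
  have := @khintchine_lower R n b radius radius_gt0.
  have -> : (\sum_(j < n) b j ^+ 2 = (kap / n%:R) ^+ 2 *
      \sum_(i < n) (f1 (tnth x i) - f2 (tnth x i)) ^+ 2)%R.
    by rewrite mulr_sumr; apply: eq_bigr => j _; rewrite exprMn.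
  set A := (\sum_(i < n) _)%R.
  have A4 : (A <= n%:R * 4)%R.
    apply: (@le_trans _ _ (\sum_(i < n) 4)%R); last first.
      by rewrite sumr_const card_ord mulr_natl.
    apply: ler_sum => i _; rewrite -[leLHS]real_normK ?num_real//.
    rewrite (_ : 4%R = 2 ^+ 2 :> R)%R; last by ring.
    rewrite lerXn2r ?nnegrE// ler_norml.
    by have := F1 Ff1 (tnth x i); have := F1 Ff2 (tnth x i); lra.
  have c0 : (0 <= (kap / n%:R) ^+ 2 :> R)%R by exact: sqr_ge0.
  move=> /(_ _) K; apply: le_trans (ler_wpM2l _ (K _)) => //.
    rewrite le_eqVlt; apply/orP; left; apply/eqP; field.
    by rewrite !gt_eqF.
  rewrite radius2.
  apply: (@le_trans _ _ (3 * ((kap / n%:R) ^+ 2 * (n%:R * 4))))%R.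
    by rewrite ler_pM2l// ler_wpM2l.
  by rewrite le_eqVlt; apply/orP; left; apply/eqP; field; rewrite gt_eqF.
apply: sign_avg_le => e; rewrite add0r signed_sumD.
have -> : signed_sum e b = (signed_sum e (a f1) - signed_sum e (a f2))%R.
  rewrite -mulN1r -signed_sumZ -signed_sumD; congr signed_sum.
  by apply/funext => j; rewrite aE.
have bs : bounded_on_set F (fun f => signed_sum e (a f)).
  by apply: bounded_on_sum => j; do 2 apply: bounded_onZ; exact: bdev.
have := sup_on_ub bs Ff1; have := sup_on_ub bs Ff2.
rewrite -/(a _); set S := sup_on _ _ => h2 h1.
by have [d0|d0] := ger0P (signed_sum e (a f1) - signed_sum e (a f2)); lra.
Qed.

(** Averaging [noise_mean_ge] over the design gives W >= c n/4. In the square, 1536 = 256 * 6, with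
    6 coming from [radius]^2. *)
Lemma gaussian_lower_bound f1 f2 W : F f1 -> F f2 -> (0 <= W)%R ->
  (4^-1)%:E <= \int[P]_z ((f1 z - f2 z) ^+ 2)%:E ->
  \int[power_prob P n]_x \int[power_prob N n]_xi (centered_sup f0 F x xi)%:E
    = W%:E ->
  (kap ^+ 2 / (1536 * n%:R) <= W ^+ 2)%R.
Proof.
move=> Ff1 Ff2 W0 f12 EW.
have kap0 := std_normal_abs_mean_gt0 R.
pose q (z : T) := ((f1 z - f2 z) ^+ 2)%:E : \bar R.
have mq : measurable_fun [set: T] q.
  by apply/measurable_EFinP; apply: measurable_funX; apply: measurable_funB; exact: Fm.
have q0 z : 0 <= q z by rewrite lee_fin sqr_ge0.
pose c := ((kap / n%:R) ^+ 2 / (4 * radius))%R.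
have c0 : (0 <= c)%R by rewrite divr_ge0 ?sqr_ge0// mulr_ge0// ltW.
have mqi i : measurable_fun [set: n.-tuple T] (fun x => q (tnth x i)).
  by apply: measurableT_comp => //; exact: measurable_tnth.
have : (c * (n%:R / 4))%:E <= W%:E.
  rewrite -EW; apply: (@le_trans _ _ (\int[power_prob P n]_x
      (c%:E * \sum_(i < n) q (tnth x i)))).
    rewrite ge0_integralZl_EFin//; last 2 first.
    - by move=> x _; apply: sume_ge0 => i _.
    - exact: emeasurable_sum.
    rewrite ge0_integral_sum// EFinM; apply: lee_wpmul2l; first by rewrite lee_fin.
    apply: (@le_trans _ _ (\sum_(i < n) (4^-1)%:E)).
      by rewrite sumEFin lee_fin sumr_const card_ord -[(4^-1 *+ n)%R]mulr_natl.
    by apply: lee_sum => i _; rewrite (integral_power_prob_tnth P i mq q0).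
  apply: ge0_le_integral => //.
  - by move=> x _; rewrite mule_ge0// sume_ge0.
  - by apply: emeasurable_funM => //; exact: emeasurable_sum.
  - apply: (measurable_fun_fubini_tonelli_F (m2 := power_prob N n)
      (fun w => (centered_sup f0 F w.1 w.2)%:E)); first exact/measurable_EFinP.
    by move=> w; rewrite lee_fin; exact: (centered_sup_ge0 F1).
  move=> x _; apply: le_trans (noise_mean_ge x Ff1 Ff2).
  by rewrite /q sumEFin -EFinM.
rewrite lee_fin => cW.
have -> : (kap ^+ 2 / (1536 * n%:R) = (c * (n%:R / 4)) ^+ 2)%R.
  have -> : ((c * (n%:R / 4)) ^+ 2 =
      kap ^+ 4 / (256 * n%:R ^+ 2 * radius ^+ 2))%R.
    by rewrite /c; move: radius radius_gt0 => r r0; field; rewrite !gt_eqF.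
  by rewrite radius2; field; rewrite !gt_eqF.
by rewrite lerXn2r ?nnegrE// mulr_ge0// divr_ge0// ltW.
Qed.

End gaussian_lower_bound.

(** * Symmetrization *)

Section symmetrization.
Context d (T : measurableType d) (R : realType).
Local Notation N := (std_normal R).
Local Notation kap := (std_normal_abs_mean R).

Lemma sup_onZ I (D : set I) a (f : I -> R) : D !=set0 -> bounded_on_set D f ->
  (0 < a)%R -> sup_on D (fun i => a * f i)%R = (a * sup_on D f)%R.
Proof.
move=> D0 bf a0; apply/eqP; rewrite eq_le; apply/andP; split.
  by apply: sup_on_le => // i Di; rewrite ler_pM2l// sup_on_ub.
rewrite mulrC -ler_pdivlMr//; apply: sup_on_le => // i Di.
rewrite ler_pdivlMr// mulrC.
exact: (sup_on_ub (bounded_onZ a bf) Di).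
Qed.

Lemma measurable_sign_avg d' (X : measurableType d') n (K : seq bool -> X -> R) :
  (forall e, measurable_fun [set: X] (K e)) ->
  measurable_fun [set: X] (fun x => sign_avg n (K ^~ x)).
Proof.
elim: n K => [|n IH] K mK /=; first exact: mK.
apply: measurable_funM => //; apply: measurable_funD.
  exact: (IH (fun e => K (true :: e))).
exact: (IH (fun e => K (false :: e))).
Qed.

Lemma integral_sign_avg d' (X : measurableType d') (mu : {measure set X -> \bar R})
    n (H : seq bool -> X -> R) (c : \bar R) :
  (forall e, measurable_fun [set: X] (H e)) -> (forall e x, (0 <= H e x)%R) ->
  (forall e, \int[mu]_x (H e x)%:E = c) ->
  \int[mu]_x (sign_avg n (H ^~ x))%:E = c.
Proof.
elim: n H => [|n IH] H mH H0 Hc; first exact: Hc.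
have sa0 m (K : seq bool -> X -> R) x : (forall e x, (0 <= K e x)%R) ->
    (0 <= sign_avg m (K ^~ x))%R.
  by move=> K0; rewrite -(sign_avg_cst m 0%R); exact: sign_avg_le.
have IHb b := IH (fun e => H (b :: e)) (fun e => mH (b :: e))
  (fun e => H0 (b :: e)) (fun e => Hc (b :: e)).
have E x : (sign_avg n.+1 (H ^~ x))%:E =
    (2^-1)%:E * ((sign_avg n (fun e => H (true :: e) x))%:E +
                 (sign_avg n (fun e => H (false :: e) x))%:E).
  by rewrite -EFinD -EFinM /= mulrC.
under eq_integral do rewrite E.
have mb b : measurable_fun [set: X]
    (fun x => (sign_avg n (fun e => H (b :: e) x))%:E : \bar R).
  by apply/measurable_EFinP; apply: (measurable_sign_avg n (K := fun e => H (b :: e))).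
have nb b x : [set: X] x -> 0 <= (sign_avg n (fun e => H (b :: e) x))%:E.
  by move=> _; rewrite lee_fin; exact: (sa0 n (fun e => H (b :: e))).
rewrite ge0_integralZl_EFin//; last 2 first.
- by move=> x _; rewrite adde_ge0// nb.
- exact: emeasurable_funD.
rewrite ge0_integralD//; [|exact: nb|exact: nb].
rewrite !IHb; have : 0 <= c.
  by rewrite -(Hc [::]); apply: integral_ge0 => x _; rewrite lee_fin.
case: c {IH IHb Hc} => [r r0|_|//]; last by rewrite addey// gt0_muley// lte_fin.
by rewrite -EFinD -EFinM; congr (_%:E); field.
Qed.

Variables (P : probability T R) (F U : set (T -> R)) (f0 : T -> R) (n : nat).
Hypothesis Fm : forall f, F f -> measurable_fun [set: T] f.
Hypothesis F1 : forall f, F f -> forall z, (- 1 <= f z <= 1)%R.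
Hypothesis Ff0 : F f0.
Hypothesis UF : U `<=` F.
Hypothesis Uf0 : U f0.
Hypothesis Ucvx : forall f f' s, U f -> U f' -> (0 <= s <= 1)%R ->
  U (fun z => f z + s * (f' z - f z))%R.
Hypothesis n0 : (0 < n)%N.
Hypothesis mU : forall n,
  measurable_fun [set: n.-tuple T * n.-tuple (measurableTypeR R)]
    (fun w => gaussian_sup U w.1 w.2).

Let n0R : (0 < n%:R :> R)%R. Proof. by rewrite ltr0n. Qed.
Let U0 : U !=set0. Proof. by exists f0. Qed.

Let mZ m : measurable_fun [set: m.-tuple T * m.-tuple (measurableTypeR R)]
  (fun w => centered_sup f0 U w.1 w.2).
Proof.
exact: (@measurable_centered_sup _ _ _ F F1 f0 Ff0 m (fun=> U) (fun=> UF)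
  (fun=> Uf0) Fm (@mU m)).
Qed.

Definition abs_dev (x : n.-tuple T) f : R :=
  (\sum_(i < n) `|scaled_dev f0 x f i|)%R.

(** The second sample stands for P: averaged over it, [abs_dev] becomes the L1(P) distance to f0.
    For fixed samples only finitely many values of f matter, as the measurability argument
    requires. *)
Definition ghost_gap (w : n.-tuple T * n.-tuple T) : R :=
  sup_on U (fun f => abs_dev w.1 f - abs_dev w.2 f)%R.

Let bdev (x : n.-tuple T) j : bounded_on_set U (fun f => scaled_dev f0 x f j).
Proof. exact: (bounded_scaled_dev F1). Qed.

Let babs (x : n.-tuple T) j :
  bounded_on_set U (fun f => `|scaled_dev f0 x f j|%R).
Proof. by have [M H] := bdev x j; exists M => f Uf; rewrite normr_id H. Qed.

Lemma bounded_abs_dev x : bounded_on_set U (abs_dev x).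
Proof. by apply: bounded_on_sum => j; exact: babs. Qed.

Lemma bounded_ghost_gap w : bounded_on_set U (fun f => abs_dev w.1 f - abs_dev w.2 f)%R.
Proof.
apply: bounded_onD; first exact: bounded_abs_dev.
have [M H] := bounded_abs_dev w.2.
by exists M => f Uf; rewrite normrN H.
Qed.

Lemma ghost_gap_ge0 w : (0 <= ghost_gap w)%R.
Proof.
have := sup_on_ub (bounded_ghost_gap w) Uf0.
rewrite /abs_dev !big1 ?subrr// => i _; by rewrite /scaled_dev subrr mulr0 normr0.
Qed.

Let cat2 (w : n.-tuple T * n.-tuple T) : (n + n).-tuple T :=
  [tuple of w.1 ++ w.2].

Let mcat2 : measurable_fun [set: n.-tuple T * n.-tuple T] cat2.
Proof.
apply/measurable_fun_tnthP => i; case: (split_ordP i) => j ->.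
  rewrite (_ : _ \o _ = fun w : n.-tuple T * n.-tuple T => tnth w.1 j).
    exact: (measurableT_comp (measurable_tnth j) measurable_fst).
  by apply/funext => w /=; rewrite tnth_lshift.
rewrite (_ : _ \o _ = fun w : n.-tuple T * n.-tuple T => tnth w.2 j).
  exact: (measurableT_comp (measurable_tnth j) measurable_snd).
by apply/funext => w /=; rewrite tnth_rshift.
Qed.

(* The support function of the convex set {(f(z_j) - f0(z_j))_j | f in U} is a
   Gaussian supremum over the doubled sample z, hence measurable. *)
Lemma measurable_ghost_gap : measurable_fun [set: n.-tuple T * n.-tuple T] ghost_gap.
Proof.
pose V (f : T -> R) w (j : 'I_(n + n)) : R :=
  (f (tnth (cat2 w) j) - f0 (tnth (cat2 w) j))%R.
pose phi (v : 'I_(n + n) -> R) : R :=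
  (\sum_(i < n) n%:R^-1 * `|v (lshift n i)| -
   \sum_(i < n) n%:R^-1 * `|v (rshift n i)|)%R.
have -> : ghost_gap = (fun w => sup_on U (fun f => phi (V f w))).
  apply/funext => w; congr sup_on; apply/funext => f; rewrite /phi /V /abs_dev.
  congr (_ - _)%R; apply: eq_bigr => i _; rewrite /scaled_dev normrM.
    by rewrite tnth_lshift ger0_norm ?invr_ge0.
  by rewrite tnth_rshift ger0_norm ?invr_ge0.
apply: (@measurable_sup_on_convex _ _ _ _ U _ V 2%R) => //.
- move=> f w j /UF Ff; rewrite /V ler_norml.
  by have := F1 Ff (tnth (cat2 w) j); have := F1 Ff0 (tnth (cat2 w) j); lra.
- move=> f f' s Uf Uf' s01; exists (fun z => f z + s * (f' z - f z))%R.
    exact: Ucvx.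
  by move=> w j; rewrite /V; ring.
- move=> p; pose xi : (n + n).-tuple R := [tuple p j | j < n + n].
  have nn0 : (0 < (n + n)%:R :> R)%R by rewrite ltr0n addn_gt0 n0.
  rewrite (_ : (fun w => _) = fun w =>
      ((n + n)%:R * centered_sup f0 U (cat2 w) xi)%R); last first.
    apply/funext => w; rewrite /centered_sup -sup_onZ//; last first.
      exact: (bounded_centered_sup F1).
    congr sup_on; apply/funext => f.
    rewrite /dot /weighted_sum mulr_sumr; apply: eq_bigr => j _.
    rewrite tnth_mktuple /scaled_dev /V.
    by move: (n + n)%:R nn0 => k k0; field; rewrite gt_eqF.
  apply: measurable_funM => //.
  apply: (measurableT_comp (@mZ (n + n)%N)
    (g := fun w : n.-tuple T * n.-tuple T => (cat2 w, xi))).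
  exact: measurable_fun_pair.
- move=> v w; rewrite big_split_ord /= /phi.
  (* Each half of [phi] is 1-Lipschitz for the l1 norm because n^-1 <= 1. *)
  have D (k : 'I_n -> 'I_(n + n)) :
      (`|\sum_(i < n) n%:R^-1 * `|v (k i)| - \sum_(i < n) n%:R^-1 * `|w (k i)| |
       <= \sum_(i < n) `|v (k i) - w (k i)|)%R.
    rewrite -sumrB (le_trans (ler_norm_sum _ _ _))// ler_sum// => i _.
    rewrite -mulrBr normrM ger0_norm ?invr_ge0//.
    apply: (@le_trans _ _ (1 * `|v (k i) - w (k i)|)%R); last by rewrite mul1r.
    apply: ler_pM; rewrite ?invr_ge0//; last exact: ler_dist_dist.
    by rewrite invf_le1// ler1n.
  have key (a b a' b' : R) : (a - b - (a' - b') = (a - a') - (b - b'))%R by ring.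
  rewrite key.
  apply: (le_trans (ler_normB _ _)); apply: lerD.
    exact: (D (lshift n)).
  exact: (D (@rshift n n)).
Qed.

Lemma measurable_ghost_gapE :
  measurable_fun [set: n.-tuple T * n.-tuple T] (fun w => (ghost_gap w)%:E : \bar R).
Proof. by apply/measurable_EFinP; exact: measurable_ghost_gap. Qed.

(** Exchanging the i-th points flips the sign of the i-th difference. The supremum then splits into
    one part per sample, and the factor [kap] is inserted to match the comparison with Gaussians. *)
Let ghost_gap_swap e (x x' : n.-tuple T) :
  (ghost_gap (pick_tuple e x x', pick_tuple e x' x) <=
    kap^-1 * (sup_on U (fun f => signed_sum e (fun j => kap * `|scaled_dev f0 x f j|)) +
      sup_on U (fun f => signed_sum e (fun j => - (kap * `|scaled_dev f0 x' f j|)))))%R.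
Proof.
have kap0 := std_normal_abs_mean_gt0 R.
apply: sup_on_le => // f Uf; rewrite ler_pdivlMl//=.
have -> : (kap * (abs_dev (pick_tuple e x x') f - abs_dev (pick_tuple e x' x) f) =
    signed_sum e (fun j => kap * `|scaled_dev f0 x f j|) +
    signed_sum e (fun j => - (kap * `|scaled_dev f0 x' f j|)))%R.
  rewrite /abs_dev -sumrB mulr_sumr /signed_sum -big_split/=.
  apply: eq_bigr => j _; rewrite /scaled_dev /sgn !tnth_mktuple.
  by case: (nth true e j); ring.
have b1 : bounded_on_set U (fun f => signed_sum e (fun j => kap * `|scaled_dev f0 x f j|)%R).
  by apply: bounded_on_sum => j; do 2 apply: bounded_onZ; exact: babs.
have b2 : bounded_on_set U (fun f => signed_sum e (fun j => - (kap * `|scaled_dev f0 x' f j|))%R).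
  apply: bounded_on_sum => j; apply: bounded_onZ.
  have [M H] := bounded_onZ kap (babs x' j); exists M => g Ug.
  by rewrite normrN H.
by rewrite lerD// ?(sup_on_ub b1)// ?(sup_on_ub b2).
Qed.

(** Contraction removes the absolute value, then signs are replaced by Gaussians. The case
    [b = false] serves the ghost sample, whose terms carry a minus sign. *)
Let sign_avg_abs_le (b : bool) (x : n.-tuple T) :
  (sign_avg n (fun e => sup_on U (fun f => signed_sum e (fun j =>
    (if b then kap * `|scaled_dev f0 x f j| else
       - (kap * `|scaled_dev f0 x f j|)))%R)))%:E <=
  \int[power_prob N n]_xi (centered_sup f0 U x xi)%:E.
Proof.
have kap0 := std_normal_abs_mean_gt0 R.
apply: le_trans (sign_avg_le_gaussian0 U0 (bdev x) _ _); last 2 first.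
- exact: (measurableT_comp (@mZ n) (pair1_measurable x)).
- by move=> xi; exact: (centered_sup_ge0 F1).
rewrite lee_fin.
pose phi (f : T -> R) j := (if b then kap * `|scaled_dev f0 x f j| else
       - (kap * `|scaled_dev f0 x f j|))%R.
have add0 (v : (T -> R) -> 'I_n -> R) :
    (fun e => sup_on U (fun f => signed_sum e (v f))) =
    (fun e => sup_on U (fun f => 0 + signed_sum e (v f))%R).
  by apply/funext => e; congr sup_on; apply/funext => f; rewrite add0r.
rewrite (add0 phi) (add0 (fun f j => kap * scaled_dev f0 x f j)%R).
apply: sign_avg_contraction => //.
- exact: bounded_on_cst.
- move=> j; have [M H] := bounded_onZ kap (babs x j); exists M => f Uf.
  by rewrite /phi; case: (b); rewrite ?normrN H.
- by move=> j; apply: bounded_onZ; exact: bdev.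
move=> j f g Uf Ug; rewrite -mulrBr normrM (gtr0_norm kap0).
have -> : (`|phi f j - phi g j| =
    kap * `| `|scaled_dev f0 x f j| - `|scaled_dev f0 x g j| |)%R.
  rewrite /phi; case: (b).
    by rewrite -mulrBr normrM (gtr0_norm kap0).
  by rewrite -opprD normrN -mulrBr normrM (gtr0_norm kap0).
by rewrite ler_pM2l//; exact: ler_dist_dist.
Qed.

(** The law of the two samples is invariant under every exchange, so the integral equals that of the
    average over exchanges. Each of the two samples then contributes W(U)/[kap]. *)
Lemma ghost_gap_symmetrization :
  \int[power_prob P n]_x \int[power_prob P n]_x' (ghost_gap (x, x'))%:E <=
  (2 / kap)%:E * \int[power_prob P n]_x \int[power_prob N n]_xi
    (centered_sup f0 U x xi)%:E.
Proof.
have kap0 := std_normal_abs_mean_gt0 R.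
pose M x := \int[power_prob N n]_xi (centered_sup f0 U x xi)%:E.
have M0 x : 0 <= M x.
  by apply: integral_ge0 => xi _; rewrite lee_fin; exact: (centered_sup_ge0 F1).
have mM : measurable_fun [set: n.-tuple T] M.
  apply: (measurable_fun_fubini_tonelli_F (m2 := power_prob N n)
      (fun w => (centered_sup f0 U w.1 w.2)%:E)); first by apply/measurable_EFinP; exact: mZ.
  by move=> w; rewrite lee_fin; exact: (centered_sup_ge0 F1).
pose H e (w : n.-tuple T * n.-tuple T) :=
  ghost_gap (pick_tuple e w.1 w.2, pick_tuple e w.2 w.1).
have mH e : measurable_fun [set: n.-tuple T * n.-tuple T] (H e).
  apply: (measurableT_comp measurable_ghost_gap (g := fun w : n.-tuple T * n.-tuple T =>
    (pick_tuple e w.1 w.2, pick_tuple e w.2 w.1))).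
  have mp := @measurable_pick_tuple _ T e n.
  apply: measurable_fun_pair => //.
  exact: (measurableT_comp mp (@measurable_swap _ _ _ _)).
have H0 e w : (0 <= H e w)%R by exact: ghost_gap_ge0.
have g0 (w : n.-tuple T * n.-tuple T) : 0 <= (ghost_gap w)%:E.
  by rewrite lee_fin ghost_gap_ge0.
have HI e : \int[power_prob P n \x power_prob P n]_w (H e w)%:E =
    \int[power_prob P n]_x \int[power_prob P n]_x' (ghost_gap (x, x'))%:E.
  have mHE : measurable_fun [set: n.-tuple T * n.-tuple T]
    (fun w => (H e w)%:E : \bar R) by apply/measurable_EFinP; exact: mH.
  have HE0 w : 0 <= (H e w)%:E by rewrite lee_fin.
  rewrite [LHS](fubini_tonelli1 (m1 := power_prob P n) (m2 := power_prob P n) _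
    mHE HE0).
  exact: (integral_swap P e measurable_ghost_gapE g0).
rewrite -(@integral_sign_avg _ _ _ n H _ mH H0 HI).
have mMM : measurable_fun [set: n.-tuple T * n.-tuple T]
    (fun w => M w.1 + M w.2).
  apply: emeasurable_funD; first exact: (measurableT_comp mM measurable_fst).
  exact: (measurableT_comp mM measurable_snd).
have MM0 (w : n.-tuple T * n.-tuple T) : 0 <= M w.1 + M w.2 by rewrite adde_ge0.
apply: (@le_trans _ _ (\int[power_prob P n \x power_prob P n]_w
    ((kap^-1)%:E * (M w.1 + M w.2)))).
  apply: ge0_le_integral => //.
  - move=> w _; rewrite lee_fin -(sign_avg_cst n 0%R).
    by apply: sign_avg_le => e; exact: H0.
  - by apply/measurable_EFinP; exact: measurable_sign_avg.
  - exact: emeasurable_funM.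
  move=> [x x'] _ /=.
  apply: (@le_trans _ _ ((kap^-1 * (
     sign_avg n (fun e => sup_on U (fun f => signed_sum e
       (fun j => kap * `|scaled_dev f0 x f j|))) +
     sign_avg n (fun e => sup_on U (fun f => signed_sum e
       (fun j => - (kap * `|scaled_dev f0 x' f j|)))))%R)%R%:E)).
    rewrite lee_fin -sign_avgD -sign_avgZ; apply: sign_avg_le => e.
    exact: ghost_gap_swap.
  rewrite EFinM; apply: lee_wpmul2l; first by rewrite lee_fin invr_ge0 ltW.
  rewrite EFinD; apply: leeD.
    exact: (sign_avg_abs_le true).
  exact: (sign_avg_abs_le false).
rewrite ge0_integralZl_EFin//; last by rewrite invr_ge0 ltW.
rewrite (fubini_tonelli1 (m1 := power_prob P n) (m2 := power_prob P n) _ mMM MM0).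
have -> : \int[power_prob P n]_x fubini_F (power_prob P n)
    (fun w => M w.1 + M w.2) x = \int[power_prob P n]_x M x + \int[power_prob P n]_x M x.
  rewrite /fubini_F /=.
  under eq_integral do rewrite ge0_integralD// integral_prob_cst.
  rewrite ge0_integralD//; last by move=> x _; exact: integral_ge0.
  by rewrite integral_prob_cst.
rewrite -/(M _) EFinM -[X in _ <= X]muleA muleCA.
apply: lee_wpmul2l; first by rewrite lee_fin invr_ge0 ltW.
by rewrite mule_natl mule2n.
Qed.

End symmetrization.

(** * The least squares inequality *)

Section least_squares_inequality.
Context d (T : measurableType d) (R : realType).
Local Notation N := (std_normal R).
Local Notation kap := (std_normal_abs_mean R).
Implicit Types (P : probability T R) (F : set (T -> R)) (f : T -> R).

Lemma Lnorm2_le (mu : {measure set T -> \bar R}) (h : T -> R) (r : R) :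
  (0 <= r)%R ->
  ('N[mu]_2%:E[EFin \o h] <= r%:E) = (\int[mu]_z (h z ^+ 2)%:E <= (r ^+ 2)%:E).
Proof.
move=> r0; have two0 : 2%R != 0%R :> R by [].
have -> : \int[mu]_z (h z ^+ 2)%:E = 'N[mu]_2%:E[EFin \o h] `^ 2.
  rewrite poweR_Lnorm//; apply: eq_integral => z _ /=.
  by rewrite powR_mulrn// real_normK// num_real.
have := Lnorm_ge0 mu 2%:E (EFin \o h).
case: ('N[mu]_2%:E[EFin \o h]) => [s| |]//; last first.
  by rewrite poweRyr// !leye_eq.
by rewrite lee_fin => s0; rewrite poweR_EFin !lee_fin powR_mulrn// ler_pXn2r.
Qed.

Lemma convex_set_segment F f f' (s : R) : convex_set F -> F f -> F f' ->
  (0 <= s <= 1)%R -> F (fun z => f z + s * (f' z - f z))%R.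
Proof.
move=> cF Ff Ff' /andP[s0 s1].
have := cF f' f (Itv01 s0 s1); rewrite !inE => /(_ Ff' Ff).
congr F; apply/funext => z.
rewrite [LHS](_ : _ = (s * f' z + (1 - s) * f z)%R)//.
by ring.
Qed.

(** Convexity of the squared norm is checked pointwise: the defect is s (1 - s) (f' - f)^2. This
    makes the ball convex, as the measurability of [ghost_gap] demands. *)
Lemma L2ball_segment P F f0 t f f' (s : R) :
  (forall f, F f -> measurable_fun [set: T] f) -> convex_set F -> F f0 ->
  (0 <= t)%R -> L2ball P F f0 t f -> L2ball P F f0 t f' ->
  (0 <= s <= 1)%R -> L2ball P F f0 t (fun z => f z + s * (f' z - f z))%R.
Proof.
move=> Fm cF Ff0 t0 [Ff bf] [Ff' bf'] s01; split; first exact: (convex_set_segment cF Ff Ff' s01).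
move: bf bf'; rewrite !Lnorm2_le// => bf bf'.
have /andP[s0 s1] := s01.
have mq g : F g -> measurable_fun [set: T] (fun z => ((g \- f0)%R z ^+ 2)%:E : \bar R).
  move=> Fg; apply/measurable_EFinP; apply: measurable_funX.
  by apply: measurable_funB; exact: Fm.
have q0 g (z : T) : [set: T] z -> 0 <= ((g \- f0)%R z ^+ 2)%:E.
  by move=> _; rewrite lee_fin sqr_ge0.
apply: (@le_trans _ _ (\int[P]_z ((1 - s)%:E * ((f \- f0)%R z ^+ 2)%:E +
    s%:E * ((f' \- f0)%R z ^+ 2)%:E))).
  apply: ge0_le_integral => //.
  - by move=> z _; exact: q0.
  - exact: (mq _ (convex_set_segment cF Ff Ff' s01)).
  - by apply: emeasurable_funD; apply: emeasurable_funM => //; exact: mq.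
  move=> z _; rewrite -!EFinM -EFinD lee_fin /=.
  have := sqr_ge0 (f' z - f z); set a := f z; set b := f' z; set c := f0 z => h.
  rewrite -subr_ge0.
  have -> : ((1 - s) * (a - c) ^+ 2 + s * (b - c) ^+ 2 -
    (a + s * (b - a) - c) ^+ 2 = s * (1 - s) * (b - a) ^+ 2)%R by ring.
  by apply: mulr_ge0 => //; apply: mulr_ge0 => //; rewrite subr_ge0.
rewrite ge0_integralD//; last 4 first.
- by move=> z _; rewrite mule_ge0 ?q0// lee_fin subr_ge0.
- by apply: emeasurable_funM => //; exact: mq.
- by move=> z _; rewrite mule_ge0 ?q0// lee_fin.
- by apply: emeasurable_funM => //; exact: mq.
have Zl k g : (0 <= k)%R -> F g ->
    \int[P]_z (k%:E * ((g \- f0)%R z ^+ 2)%:E) =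
    k%:E * \int[P]_z ((g \- f0)%R z ^+ 2)%:E.
  by move=> k0 Fg; rewrite ge0_integralZl_EFin//; [exact: q0|exact: mq].
have s1' : (0 <= 1 - s)%R by rewrite subr_ge0.
rewrite !Zl//.
rewrite [leRHS](_ : _ = (1 - s)%:E * (t ^+ 2)%:E + s%:E * (t ^+ 2)%:E).
  by apply: leeD; apply: lee_wpmul2l => //; rewrite lee_fin// subr_ge0.
by rewrite -!EFinM -EFinD; congr (_%:E); ring.
Qed.

Lemma L2ball_center (mu : {measure set T -> \bar R}) F f0 (t : R) :
  F f0 -> (0 <= t)%R -> L2ball mu F f0 t f0.
Proof.
move=> Ff0 t0; split => //; rewrite Lnorm2_le//.
rewrite (_ : (fun _ => _) = cst 0); first by rewrite integral0 lee_fin sqr_ge0.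
by apply/funext => z; rewrite /= subrr expr0n.
Qed.

(* Optimality of the least squares fit against the segment towards g. *)
Lemma least_squares_variational F n (x : n.-tuple T) (xi : n.-tuple R) f0 f g :
  convex_set F -> (forall h, F h -> forall z, (- 1 <= h z <= 1)%R) ->
  least_squares F x (response f0 x xi) f -> F g ->
  (weighted_sum xi (scaled_dev f0 x g) <=
   weighted_sum xi (scaled_dev f0 x f) + 2 * abs_dev f0 x f)%R.
Proof.
move=> cF F1 [Ff fmin] Fg.
pose r i := (tnth xi i - (f (tnth x i) - f0 (tnth x i)))%R.
pose e i := (g (tnth x i) - f (tnth x i))%R.
have rss_eq (s : R) : rss x (response f0 x xi)
    (fun z => f z + s * (g z - f z))%R =
    (\sum_(i < n) r i ^+ 2 - 2 * s * (\sum_(i < n) r i * e i) +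
     s ^+ 2 * \sum_(i < n) e i ^+ 2)%R.
  rewrite /rss !mulr_sumr -sumrB -big_split /=; apply: eq_bigr => i _.
  by rewrite tnth_mktuple /r /e; ring.
pose S := (\sum_(i < n) r i * e i)%R; pose E := (\sum_(i < n) e i ^+ 2)%R.
have E0 : (0 <= E)%R by apply: sumr_ge0 => i _; exact: sqr_ge0.
have seg (s : R) : (0 < s <= 1)%R -> (2 * S <= s * E)%R.
  move=> /andP[s0 s1]; have s01 : (0 <= s <= 1)%R by rewrite ltW.
  have := fmin _ (convex_set_segment cF Ff Fg s01); rewrite rss_eq -/S -/E.
  have -> : rss x (response f0 x xi) f = (\sum_(i < n) r i ^+ 2)%R.
    rewrite /rss; apply: eq_bigr => i _.
    by rewrite tnth_mktuple /r; congr (_ ^+ 2)%R; ring.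
  move=> H; have : (s * (2 * S) <= s * (s * E))%R by lra.
  by rewrite ler_pM2l.
(* First-order optimality, with the limit s -> 0 replaced by the explicit s = min(1, S/(E + 1)), for
   which s E < S if S > 0. *)
have S0 : (S <= 0)%R.
  rewrite leNgt; apply/negP => Spos.
  have m0 : (0 < Num.min 1 (S / (E + 1)))%R.
    by rewrite lt_min ltr01/= divr_gt0// ltr_wpDl.
  have m1 : (Num.min 1 (S / (E + 1)) <= 1)%R by rewrite ge_min lexx.
  have := seg _ (introT andP (conj m0 m1)).
  have : (Num.min 1 (S / (E + 1)) * E <= S / (E + 1) * E)%R.
    by rewrite ler_wpM2r// ge_min lexx orbT.
  have : (S / (E + 1) * E <= S)%R.
    rewrite mulrAC ler_pdivrMr ?ltr_wpDl//.
    by apply: ler_wpM2l; [exact: ltW|rewrite lerDl].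
  by lra.
(* With u = f - f0, S <= 0 reads <xi - u, g - f> <= 0. The factor 2 in the claim comes from |g - f|
   <= 2 in the product u (g - f). *)
rewrite -subr_ge0.
apply: (@le_trans _ _ (- (n%:R^-1 * S))%R).
  by rewrite oppr_ge0 mulr_ge0_le0// invr_ge0.
rewrite /S /weighted_sum /abs_dev !mulr_sumr -sumrN -big_split -sumrB /=.
apply: ler_sum => i _; rewrite /scaled_dev /r /e.
set u := (f (tnth x i) - f0 (tnth x i))%R; set k := (n%:R^-1)%R.
have k0 : (0 <= k)%R by rewrite invr_ge0.
have -> : (`|k * u| = k * `|u|)%R by rewrite normrM ger0_norm.
rewrite -subr_ge0.
have -> : (tnth xi i * (k * u) + 2 * (k * `|u|) -
    tnth xi i * (k * (g (tnth x i) - f0 (tnth x i))) -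
    - (k * ((tnth xi i - u) * (g (tnth x i) - f (tnth x i)))) =
    k * (2 * `|u| - u * (g (tnth x i) - f (tnth x i))))%R.
  by rewrite /u; ring.
rewrite mulr_ge0// subr_ge0 (le_trans (ler_norm _))// normrM mulrC ler_wpM2r//.
by rewrite ler_norml; have := F1 _ Ff (tnth x i); have := F1 _ Fg (tnth x i); lra.
Qed.

Lemma integral_abs_dev P n (f0 f : T -> R) :
  (0 < n)%N -> measurable_fun [set: T] f -> measurable_fun [set: T] f0 ->
  \int[power_prob P n]_x (abs_dev f0 x f)%:E = \int[P]_z `|f z - f0 z|%:E.
Proof.
move=> n0 mf mf0; pose q (z : T) : \bar R := `|f z - f0 z|%:E.
have mq : measurable_fun [set: T] q.
  apply/measurable_EFinP; apply: (measurableT_comp (@normr_measurable R setT)).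
  exact: measurable_funB.
have q0 z : 0 <= q z by rewrite lee_fin.
have mqi i : measurable_fun [set: n.-tuple T]
    (fun x : n.-tuple T => (n%:R^-1)%:E * q (tnth x i)).
  apply: emeasurable_funM => //; apply: measurableT_comp => //.
  exact: measurable_tnth.
transitivity (\int[power_prob P n]_x
    \sum_(i < n) (n%:R^-1)%:E * q (tnth x i)).
  apply: eq_integral => x _; rewrite /abs_dev -sumEFin; apply: eq_bigr => i _.
  by rewrite /scaled_dev normrM ger0_norm ?invr_ge0.
rewrite ge0_integral_sum//; last first.
  by move=> i x _; rewrite mule_ge0// lee_fin invr_ge0.
have E i : \int[power_prob P n]_x ((n%:R^-1)%:E * q (tnth x i)) =
    (n%:R^-1)%:E * \int[P]_z q z.
  rewrite ge0_integralZl_EFin ?invr_ge0//.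
    by rewrite integral_power_prob_tnth.
  by apply: measurableT_comp => //; exact: measurable_tnth.
under eq_bigr do rewrite E.
rewrite -ge0_sume_distrl; last by move=> i _; rewrite lee_fin invr_ge0.
rewrite sumEFin sumr_const card_ord -[(n%:R^-1 *+ n)%R]mulr_natl divff.
  by rewrite mul1e.
by rewrite pnatr_eq0 -lt0n.
Qed.

Variables (P : probability T R) (F : set (T -> R)) (f0 : T -> R) (n : nat) (t : R).
Hypothesis Fm : forall f, F f -> measurable_fun [set: T] f.
Hypothesis F1 : forall f, F f -> forall z, (- 1 <= f z <= 1)%R.
Hypothesis Fcvx : convex_set F.
Hypothesis Ff0 : F f0.
Hypothesis t0 : (0 < t)%R.
Hypothesis n0 : (0 < n)%N.
Hypothesis mU : forall n,
  measurable_fun [set: n.-tuple T * n.-tuple (measurableTypeR R)]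
    (fun w => gaussian_sup (L2ball P F f0 t) w.1 w.2).
Local Notation U := (L2ball P F f0 t).

Let UF : U `<=` F. Proof. by move=> f []. Qed.
Let Uf0 : U f0. Proof. by apply: L2ball_center => //; exact: ltW. Qed.
Let Ucvx f f' s : U f -> U f' -> (0 <= s <= 1)%R ->
  U (fun z => f z + s * (f' z - f z))%R.
Proof. by apply: L2ball_segment => //; exact: ltW. Qed.
Let F0 : F !=set0. Proof. by exists f0. Qed.
Let FF : F `<=` F. Proof. exact: subset_refl. Qed.

(** The defining inequality of the supremum is integrated over the ghost sample alone. As the bound
    holds for every f in U, it applies to the fit, which depends on the first sample. *)
Lemma abs_dev_le_ghost (x : n.-tuple T) f : U f ->
  (abs_dev f0 x f)%:E <=
  \int[power_prob P n]_x' (ghost_gap U f0 (x, x'))%:E +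
  \int[P]_z `|f z - f0 z|%:E.
Proof.
move=> Uf; have Ff := UF Uf.
have mg := measurable_ghost_gap Fm F1 Ff0 UF Uf0 Ucvx n0 mU.
have g0 w : (0 <= ghost_gap U f0 (n := n) w)%R by exact: (ghost_gap_ge0 F1 Ff0 UF).
have mgx : measurable_fun [set: n.-tuple T]
    (fun x' => (ghost_gap U f0 (x, x'))%:E : \bar R).
  apply/measurable_EFinP; exact: (measurableT_comp mg (pair1_measurable x)).
have ma : measurable_fun [set: n.-tuple T]
    (fun x' : n.-tuple T => (abs_dev f0 x' f)%:E : \bar R).
  apply/measurable_EFinP; apply: measurable_sum => i.
  apply: (measurableT_comp (@normr_measurable R setT)).
  apply: measurable_funM => //; apply: measurable_funB.
    exact: (measurableT_comp (Fm Ff) (measurable_tnth i)).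
  exact: (measurableT_comp (Fm Ff0) (measurable_tnth i)).
have a0 (x' : n.-tuple T) : (0 <= abs_dev f0 x' f)%R by apply: sumr_ge0.
rewrite -(integral_abs_dev P n0 (Fm Ff) (Fm Ff0)) -ge0_integralD//; last 2 first.
- by move=> x' _; rewrite lee_fin.
- by move=> x' _; rewrite lee_fin.
rewrite -[leLHS](integral_prob_cst (power_prob P n)).
apply: ge0_le_integral => //.
- by move=> x' _; rewrite lee_fin.
- exact: emeasurable_funD.
move=> x' _; rewrite -EFinD lee_fin -lerBlDr.
exact: (sup_on_ub (bounded_ghost_gap F1 Ff0 UF (x, x')) Uf).
Qed.

(** Pointwise 2u <= delta + u^2/delta, which trades the L1 distance for the squared loss at the
    price [delta]. *)
Lemma integral_abs_le_sqr f (delta : R) : F f -> (0 < delta)%R ->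
  2%:E * \int[P]_z `|f z - f0 z|%:E <=
  delta%:E + (delta^-1)%:E * \int[P]_z ((f z - f0 z) ^+ 2)%:E.
Proof.
move=> Ff d0.
have mq : measurable_fun [set: T] (fun z => ((f z - f0 z) ^+ 2)%:E : \bar R).
  apply/measurable_EFinP; apply: measurable_funX.
  by apply: measurable_funB; exact: Fm.
have ma : measurable_fun [set: T] (fun z => `|f z - f0 z|%:E : \bar R).
  apply/measurable_EFinP; apply: (measurableT_comp (@normr_measurable R setT)).
  by apply: measurable_funB; exact: Fm.
have q0 z : [set: T] z -> 0 <= ((f z - f0 z) ^+ 2)%:E.
  by move=> _; rewrite lee_fin sqr_ge0.
have di0 : (0 <= delta^-1)%R by rewrite invr_ge0 ltW.
rewrite -ge0_integralZl_EFin// -ge0_integralZl_EFin//.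
rewrite -[X in X + _](integral_prob_cst P) -ge0_integralD//; last 3 first.
- by move=> z _; rewrite lee_fin ltW.
- by move=> z _; rewrite mule_ge0// q0.
- exact: emeasurable_funM.
apply: ge0_le_integral => //.
- exact: emeasurable_funM.
- by apply: emeasurable_funD => //; exact: emeasurable_funM.
move=> z _; rewrite -!EFinM -EFinD lee_fin -subr_ge0.
set v := (f z - f0 z)%R.
have -> : (v ^+ 2 = `|v| ^+ 2)%R by rewrite real_normK ?num_real.
set u := `|v|%R.
have -> : (delta + delta^-1 * u ^+ 2 - 2 * u = delta^-1 * (u - delta) ^+ 2)%R.
  by field; rewrite gt_eqF.
by rewrite mulr_ge0// sqr_ge0.
Qed.

(* If the loss of f is at most t^2 then f lies in the ball U; otherwise the loss
   absorbs Z through Z <= a Z^2 + 1 / (4 a). *)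
Lemma centered_sup_le_loss (x : n.-tuple T) (xi : n.-tuple R) f (delta a : R) :
  least_squares F x (response f0 x xi) f -> (0 < delta)%R -> (0 < a)%R ->
  (centered_sup f0 F x xi)%:E <=
  (centered_sup f0 U x xi)%:E +
  2%:E * \int[power_prob P n]_x' (ghost_gap U f0 (x, x'))%:E +
  delta%:E + (delta^-1 + (4 * a * t ^+ 2)^-1)%:E *
    \int[P]_z ((f z - f0 z) ^+ 2)%:E +
  (a * centered_sup f0 F x xi ^+ 2)%:E.
Proof.
move=> lsf d0 a0; have Ff : F f by case: lsf.
set Z := centered_sup f0 F x xi; set S := centered_sup f0 U x xi.
set D := \int[_]_x' _; set L := \int[P]_z _.
have S0 : (0 <= S)%R by exact: (centered_sup_ge0 F1).
have D0 : 0 <= D.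
  by apply: integral_ge0 => x' _; rewrite lee_fin; exact: (ghost_gap_ge0 F1 Ff0 UF).
have L0 : 0 <= L by apply: integral_ge0 => z _; rewrite lee_fin sqr_ge0.
have di0 : (0 <= delta^-1)%R by rewrite invr_ge0 ltW.
have b0 : (0 <= (4 * a * t ^+ 2)^-1)%R.
  by rewrite invr_ge0 mulr_ge0 ?sqr_ge0// mulr_ge0// ltW.
have [Lt|Lt] := leP L (t ^+ 2)%:E.
- have Uf : U f by split => //; rewrite Lnorm2_le// ltW.
  have ZS : (Z <= S + 2 * abs_dev f0 x f)%R.
    apply: sup_on_le => // g Fg.
    apply: (le_trans (least_squares_variational Fcvx F1 lsf Fg)).
    rewrite lerD2r.
    exact: (sup_on_ub (bounded_centered_sup F1 Ff0 x xi UF) Uf).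
  apply: (@le_trans _ _ (S%:E + 2%:E * D + delta%:E + (delta^-1)%:E * L)).
    apply: (@le_trans _ _ (S%:E + 2%:E * (D + \int[P]_z `|f z - f0 z|%:E))).
      apply: (@le_trans _ _ (S%:E + 2%:E * (abs_dev f0 x f)%:E)).
        by rewrite -EFinM -EFinD lee_fin.
      apply: leeD => //; apply: lee_wpmul2l => //; exact: abs_dev_le_ghost.
    rewrite ge0_muleDr//; last by apply: integral_ge0.
    rewrite addeA -[leRHS]addeA; apply: leeD => //.
    exact: integral_abs_le_sqr.
  apply: (@le_trans _ _ (S%:E + 2%:E * D + delta%:E +
      (delta^-1 + (4 * a * t ^+ 2)^-1)%:E * L)).
    apply: leeD => //; apply: lee_wpmul2r => //.
    by rewrite lee_fin lerDl.
  by rewrite leeDl// lee_fin mulr_ge0 ?sqr_ge0// ltW.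
apply: (@le_trans _ _ ((4 * a)^-1%:E + (a * Z ^+ 2)%:E)).
  rewrite -EFinD lee_fin -subr_ge0.
  have -> : ((4 * a)^-1 + a * Z ^+ 2 - Z = a * (Z - (2 * a)^-1) ^+ 2)%R.
    by field; rewrite gt_eqF.
  by rewrite mulr_ge0 ?sqr_ge0// ltW.
apply: leeD => //.
apply: (@le_trans _ _ ((delta^-1 + (4 * a * t ^+ 2)^-1)%:E * L)).
  apply: (@le_trans _ _ ((4 * a * t ^+ 2)^-1%:E * (t ^+ 2)%:E)).
    rewrite -EFinM lee_fin le_eqVlt; apply/orP; left; apply/eqP.
    by field; rewrite !gt_eqF.
  apply: lee_pmul => //; [by rewrite lee_fin sqr_ge0| |exact: ltW].
  by rewrite lee_fin lerDr.
rewrite leeDr//; apply: adde_ge0; last by rewrite lee_fin ltW.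
by apply: adde_ge0; [rewrite lee_fin|exact: mule_ge0].
Qed.

End least_squares_inequality.

(** * The lower bound *)

Section risk_lower_bound.
Context d (T : measurableType d) (R : realType).
Local Notation N := (std_normal R).
Local Notation kap := (std_normal_abs_mean R).
Local Notation m2 := (std_normal_sqr_mean R).

(** The solution l of l (1 + 4/[kap]) = 1/4, so that the supremum over U and twice the symmetrized
    deviation together cost W/4. *)
Definition width_ratio : R := (kap / (4 * (kap + 4)))%R.

(** The variance bound (4 E xi^2 + 16 [kap]^2)/n expressed as a multiple of W^2, through 1/n <= 1536
    W^2/[kap]^2. *)
Definition moment_ratio : R :=
  (1 + (4 * m2 + 16 * kap ^+ 2) * 1536 / kap ^+ 2)%R.

Definition risk_ratio : R := (3 / 8 / (4 + 2 * moment_ratio))%R.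

Lemma moment_ratio_ge1 : (1 <= moment_ratio)%R.
Proof.
rewrite /moment_ratio lerDl; apply: divr_ge0; last exact: sqr_ge0.
apply: mulr_ge0; last exact: ler0n.
by apply: addr_ge0; apply: mulr_ge0; rewrite ?ler0n ?sqr_ge0
  ?std_normal_sqr_mean_ge0.
Qed.

Lemma width_ratio_itv : (0 < width_ratio < 1)%R.
Proof.
have kap0 := std_normal_abs_mean_gt0 R; rewrite /width_ratio.
by rewrite divr_gt0//= ?ltr_pdivrMr; lra.
Qed.

Lemma risk_ratio_itv : (0 < risk_ratio < 1)%R.
Proof.
have C1 := moment_ratio_ge1; rewrite /risk_ratio.
have C0 : (0 < 4 + 2 * moment_ratio)%R by lra.
by rewrite divr_gt0//= ltr_pdivrMr//; lra.
Qed.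

(** The terms not involving the risk r sum to W/4 + W/4 + W/8 = 5W/8, so 3W/8 <= (4/W + 2CW/t^2) r
    with C = [moment_ratio]. Multiplying by the minimum, bounded by W^2 in the first term and by t^2
    in the second, leaves (4 + 2C) W r on the right, whence [risk_ratio]. *)
Lemma balance_arith (W t r : R) : (0 < W)%R -> (0 < t)%R -> (0 <= r)%R ->
  (W <= width_ratio * W + 2 * (2 / kap * (width_ratio * W)) + W / 4 +
    ((W / 4)^-1 + (4 * (8 * moment_ratio * W)^-1 * t ^+ 2)^-1) * r +
    (8 * moment_ratio * W)^-1 * (moment_ratio * W ^+ 2))%R ->
  (risk_ratio * Num.min (W ^+ 2) (t ^+ 2) <= r)%R.
Proof.
move=> W0 t0 r0.
have kap0 := std_normal_abs_mean_gt0 R; have C1 := moment_ratio_ge1.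
rewrite /risk_ratio; move: moment_ratio C1 => C C1.
have C0 : (0 < C)%R by lra.
have -> : (width_ratio * W + 2 * (2 / kap * (width_ratio * W)) + W / 4 +
    ((W / 4)^-1 + (4 * (8 * C * W)^-1 * t ^+ 2)^-1) * r +
    (8 * C * W)^-1 * (C * W ^+ 2) =
    5 / 8 * W + (4 / W + 2 * C * W / t ^+ 2) * r)%R.
  rewrite /width_ratio; field.
  by rewrite !gt_eqF// addr_gt0.
move=> H.
have {}H : (3 / 8 * W <= (4 / W + 2 * C * W / t ^+ 2) * r)%R by lra.
set m := Num.min _ _.
have m0 : (0 < m)%R by rewrite lt_min !exprn_gt0.
have mW : (m <= W ^+ 2)%R by rewrite ge_min lexx.
have mt : (m <= t ^+ 2)%R by rewrite ge_min lexx orbT.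
have C4 : (0 < 4 + 2 * C)%R by lra.
rewrite mulrAC ler_pdivrMr// -(ler_pM2l W0).
have t2 : (0 < t ^+ 2)%R by exact: exprn_gt0.
have h1 : (m * (4 / W) <= 4 * W)%R.
  by rewrite mulrA ler_pdivrMr// mulrC -mulrA ler_pM2l// -expr2.
have h2 : (m * (2 * C * W / t ^+ 2) <= 2 * C * W)%R.
  rewrite mulrA ler_pdivrMr// mulrC ler_pM2l//.
  by rewrite !mulr_gt0.
have : (m * (3 / 8 * W) <= m * ((4 / W + 2 * C * W / t ^+ 2) * r))%R.
  by rewrite ler_pM2l.
have : ((m * (4 / W) + m * (2 * C * W / t ^+ 2)) * r <=
    (4 * W + 2 * C * W) * r)%R by rewrite ler_wpM2r// lerD.
by lra.
Qed.

Variables (P : probability T R) (F : set (T -> R)) (f0 : T -> R) (n : nat).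
Hypothesis Fm : forall f, F f -> measurable_fun [set: T] f.
Hypothesis F1 : forall f, F f -> forall z, (- 1 <= f z <= 1)%R.
Hypothesis Fcvx : convex_set F.
Hypothesis Ff0 : F f0.
Hypothesis n0 : (0 < n)%N.
Hypothesis mF : measurable_suprema P F.

Let FF : F `<=` F. Proof. exact: subset_refl. Qed.

Let mZ : measurable_fun [set: n.-tuple T * n.-tuple (measurableTypeR R)]
  (fun w => centered_sup f0 F w.1 w.2).
Proof.
exact: (@measurable_centered_sup _ _ _ F F1 f0 Ff0 n (fun=> F) (fun=> FF)
  (fun=> Ff0) Fm (mF n).1).
Qed.

Let mZE : measurable_fun [set: n.-tuple T * n.-tuple (measurableTypeR R)]
  (fun w => (centered_sup f0 F w.1 w.2)%:E : \bar R).
Proof. by apply/measurable_EFinP; exact: mZ. Qed.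

Let Z0 (x : n.-tuple T) xi : (0 <= centered_sup f0 F x xi)%R.
Proof. exact: (centered_sup_ge0 F1). Qed.

(** The random ball is contained in F and the centered supremum is monotone in the class; thus the
    criterion defining the critical radius compares W(U) with W(F). *)
Lemma emp_ball_avg_le :
  gaussian_avg P (fun x : n.-tuple T => L2ball (empirical R x) F f0 1%R) <=
  \int[power_prob P n]_x \int[power_prob N n]_xi (centered_sup f0 F x xi)%:E.
Proof.
pose G (x : n.-tuple T) := L2ball (empirical R x) F f0 1%R.
have GF x : G x `<=` F by move=> f [].
have Gf0 x : G x f0 by exact: L2ball_center.
have mG := ((mF n).2 _ Ff0).2.
rewrite (gaussian_avgE F1 Ff0 GF Gf0 Fm mG).
have mGE := measurable_centered_supE F1 Ff0 GF Gf0 Fm mG.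
have G0 (w : n.-tuple T * n.-tuple R) : 0 <= (centered_sup f0 (G w.1) w.1 w.2)%:E.
  by rewrite lee_fin; exact: (centered_sup_ge0 F1 Ff0).
apply: ge0_le_integral => //.
- by move=> x _; apply: integral_ge0 => xi _; exact: (G0 (x, xi)).
- exact: (measurable_fun_fubini_tonelli_F (m2 := power_prob N n) _ mGE G0).
- apply: (measurable_fun_fubini_tonelli_F (m2 := power_prob N n) _ mZE).
  by move=> w; rewrite lee_fin.
move=> x _; apply: ge0_le_integral => //.
- by move=> xi _; exact: (G0 (x, xi)).
- exact: (measurableT_comp mGE (pair1_measurable x)).
- exact: (measurableT_comp mZE (pair1_measurable x)).
by move=> xi _; rewrite lee_fin; exact: (centered_sup_subset F1).
Qed.

(** [centered_sup_le_loss] is integrated over design and noise. The criterion at t bounds the mean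
    supremum over U by l W, and symmetrization turns this into a bound on the ghost term. *)
Lemma risk_ge_of_radius Psi (t W : R) :
  selection_rule Psi -> (forall (x : n.-tuple T) (y : n.-tuple R),
    least_squares F x y !=set0) ->
  measurable_fun [set: n.-tuple T * n.-tuple (measurableTypeR R)]
    (erm_loss P Psi F f0) ->
  (0 < W)%R ->
  \int[power_prob P n]_x \int[power_prob N n]_xi (centered_sup f0 F x xi)%:E =
    W%:E ->
  \int[power_prob P n]_x \int[power_prob N n]_xi
    (centered_sup f0 F x xi ^+ 2)%:E <= (moment_ratio * W ^+ 2)%:E ->
  (0 < t)%R ->
  gaussian_avg P (fun _ : n.-tuple T => L2ball P F f0 t) <=
    width_ratio%:E * gaussian_avg P
      (fun x : n.-tuple T => L2ball (empirical R x) F f0 1%R) ->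
  (risk_ratio * Num.min (W ^+ 2) (t ^+ 2))%:E <= erm_risk P n Psi F f0.
Proof.
move=> selPsi lsq mL W0 EW E2 t0 tcrit.
have kap0 := std_normal_abs_mean_gt0 R.
have /andP[l0 _] := width_ratio_itv.
pose U := L2ball P F f0 t.
have UF : U `<=` F by move=> f [].
have Uf0 : U f0 by apply: L2ball_center => //; exact: ltW.
have Ucvx f f' (s : R) : U f -> U f' -> (0 <= s <= 1)%R ->
    U (fun z => f z + s * (f' z - f z))%R.
  by apply: L2ball_segment => //; exact: ltW.
have mU m : measurable_fun [set: m.-tuple T * m.-tuple (measurableTypeR R)]
    (fun w => gaussian_sup U w.1 w.2).
  exact: (((mF m).2 _ Ff0).1 t (ltW t0)).
have mSE := measurable_centered_supE F1 Ff0 (fun _ : n.-tuple T => UF)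
  (fun=> Uf0) Fm (mU n).
have S0 (w : n.-tuple T * n.-tuple R) : 0 <= (centered_sup f0 U w.1 w.2)%:E.
  by rewrite lee_fin; exact: (centered_sup_ge0 F1 Ff0).
have mg := measurable_ghost_gapE Fm F1 Ff0 UF Uf0 Ucvx n0 mU.
have g0 (w : n.-tuple T * n.-tuple T) : 0 <= (ghost_gap U f0 w)%:E.
  by rewrite lee_fin; exact: (ghost_gap_ge0 F1 Ff0 UF).
pose mu := (power_prob P n \x power_prob N n)%E.
have intZ : \int[mu]_w (centered_sup f0 F w.1 w.2)%:E = W%:E.
  rewrite -EW; apply: (fubini_tonelli1 _ mZE) => w.
  by rewrite lee_fin.
have mZ2 : measurable_fun [set: n.-tuple T * n.-tuple (measurableTypeR R)]
    (fun w => (centered_sup f0 F w.1 w.2 ^+ 2)%:E : \bar R).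
  by apply/measurable_EFinP; exact: measurable_funX.
have Z20 (w : n.-tuple T * n.-tuple R) : 0 <= (centered_sup f0 F w.1 w.2 ^+ 2)%:E.
  by rewrite lee_fin sqr_ge0.
have intZ2 : \int[mu]_w (centered_sup f0 F w.1 w.2 ^+ 2)%:E <=
    (moment_ratio * W ^+ 2)%:E.
  by apply: le_trans E2; rewrite (fubini_tonelli1 _ mZ2 Z20).
have SW : \int[power_prob P n]_x \int[power_prob N n]_xi
    (centered_sup f0 U x xi)%:E <= (width_ratio * W)%:E.
  rewrite -(gaussian_avgE F1 Ff0 (fun=> UF) (fun=> Uf0) Fm (mU n)).
  apply: (le_trans tcrit); rewrite [leRHS]EFinM -EW.
  by apply: lee_wpmul2l; [rewrite lee_fin ltW|exact: emp_ball_avg_le].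
have intS : \int[mu]_w (centered_sup f0 U w.1 w.2)%:E <= (width_ratio * W)%:E.
  by apply: le_trans SW; rewrite (fubini_tonelli1 _ mSE S0).
pose D (x : n.-tuple T) := \int[power_prob P n]_x' (ghost_gap U f0 (x, x'))%:E.
have D0 x : 0 <= D x by apply: integral_ge0 => x' _; exact: g0.
have mD : measurable_fun [set: n.-tuple T] D.
  exact: (measurable_fun_fubini_tonelli_F (m2 := power_prob P n) _ mg g0).
have mD1 : measurable_fun [set: n.-tuple T * n.-tuple (measurableTypeR R)]
    (fun w => D w.1) by exact: (measurableT_comp mD measurable_fst).
have intD : \int[mu]_w D w.1 <= (2 / kap * (width_ratio * W))%:E.
  rewrite (fubini_tonelli1 _ mD1 (fun w => D0 w.1)).
  rewrite /fubini_F /=; under eq_integral do rewrite integral_prob_cst.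
  apply: (le_trans (ghost_gap_symmetrization P Fm F1 Ff0 UF Uf0 Ucvx n0 mU)).
  by rewrite [leRHS]EFinM; apply: lee_wpmul2l => //; rewrite lee_fin divr_ge0// ltW.
pose L := erm_loss P Psi F f0 (n := n).
have L0 w : 0 <= L w by apply: integral_ge0 => z _; rewrite lee_fin sqr_ge0.
(* [delta] spends a quarter of W, and [a] is chosen so that a times the bound on the second moment
   is W/8. *)
pose delta := (W / 4)%R; pose a := ((8 * moment_ratio * W)^-1)%R.
pose b := (delta^-1 + (4 * a * t ^+ 2)^-1)%R.
have delta0 : (0 < delta)%R by rewrite divr_gt0.
have C1 := moment_ratio_ge1.
have a0 : (0 < a)%R by rewrite invr_gt0 !mulr_gt0//; lra.
have b0 : (0 <= b)%R.
  rewrite addr_ge0// invr_ge0; first exact: ltW.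
  by rewrite mulr_ge0 ?sqr_ge0// mulr_ge0// ltW.
have mA2 : measurable_fun [set: n.-tuple T * n.-tuple (measurableTypeR R)]
    (fun w => 2%:E * D w.1) by exact: emeasurable_funM.
have mA4 : measurable_fun [set: n.-tuple T * n.-tuple (measurableTypeR R)]
    (fun w => b%:E * L w) by exact: emeasurable_funM.
have mA5 : measurable_fun [set: n.-tuple T * n.-tuple (measurableTypeR R)]
    (fun w => a%:E * (centered_sup f0 F w.1 w.2 ^+ 2)%:E).
  exact: emeasurable_funM.
have A20 (w : n.-tuple T * n.-tuple R) : setT w -> 0 <= 2%:E * D w.1.
  by move=> _; rewrite mule_ge0.
have A40 (w : n.-tuple T * n.-tuple R) : setT w -> 0 <= b%:E * L w.
  by move=> _; rewrite mule_ge0.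
have A50 (w : n.-tuple T * n.-tuple R) : setT w ->
    0 <= a%:E * (centered_sup f0 F w.1 w.2 ^+ 2)%:E.
  by move=> _; rewrite mule_ge0// lee_fin ltW.
have mA12 := emeasurable_funD mSE mA2.
have A120 (w : n.-tuple T * n.-tuple R) : setT w ->
    0 <= (centered_sup f0 U w.1 w.2)%:E + 2%:E * D w.1.
  by move=> _; rewrite adde_ge0// A20.
have mA13 := emeasurable_funD mA12 (measurable_cst delta%:E).
have A130 (w : n.-tuple T * n.-tuple R) : setT w ->
    0 <= (centered_sup f0 U w.1 w.2)%:E + 2%:E * D w.1 + delta%:E.
  by move=> _; rewrite adde_ge0 ?A120// lee_fin ltW.
have mA14 := emeasurable_funD mA13 mA4.
have A140 (w : n.-tuple T * n.-tuple R) : setT w ->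
    0 <= (centered_sup f0 U w.1 w.2)%:E + 2%:E * D w.1 + delta%:E + b%:E * L w.
  by move=> _; rewrite adde_ge0 ?A130// A40.
have main : W%:E <= (width_ratio * W)%:E +
    2%:E * (2 / kap * (width_ratio * W))%:E + delta%:E +
    b%:E * erm_risk P n Psi F f0 + a%:E * (moment_ratio * W ^+ 2)%:E.
  rewrite -intZ; apply: (@le_trans _ _ (\int[mu]_w (
      (centered_sup f0 U w.1 w.2)%:E + 2%:E * D w.1 + delta%:E + b%:E * L w +
      a%:E * (centered_sup f0 F w.1 w.2 ^+ 2)%:E))).
    apply: ge0_le_integral => //.
    - by move=> w _; rewrite lee_fin.
    - exact: (emeasurable_funD mA14 mA5).
    move=> [x xi] _; rewrite -EFinM.
    apply: (centered_sup_le_loss Fm F1 Fcvx Ff0 t0 n0 mU _ delta0 a0).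
    exact: selPsi.
  rewrite ge0_integralD//; apply: leeD; last first.
    rewrite ge0_integralZl_EFin//; last exact: ltW.
    by apply: lee_wpmul2l => //; rewrite lee_fin ltW.
  rewrite ge0_integralD//; apply: leeD; last first.
    by rewrite ge0_integralZl_EFin.
  rewrite ge0_integralD//; last by move=> w _; rewrite lee_fin ltW.
  apply: leeD; last by rewrite integral_prob_cst.
  rewrite ge0_integralD//; apply: leeD => //.
  by rewrite ge0_integralZl_EFin//; apply: lee_wpmul2l.
have : 0 <= erm_risk P n Psi F f0 by apply: integral_ge0 => w _; exact: L0.
move: main; case: (erm_risk P n Psi F f0) => [r|_ _|//]; last by rewrite leey.
rewrite -!EFinM -!EFinD !lee_fin => main r0; exact: balance_arith.
Qed.

End risk_lower_bound.

Theorem theorem3p1 (R : realType) :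
  exists l c : R, [/\ (0 < l < 1)%R, (0 < c < 1)%R &
  forall (d : measure_display) (T : measurableType d) (P : probability T R)
    (F : set (T -> R)),
  convex_set F ->
  (forall f, F f -> measurable_fun [set: T] f) ->
  (forall f, F f -> forall z, (- 1 <= f z <= 1)%R) ->
  (exists f1 f2, [/\ F f1, F f2 &
    (2^-1)%R%:E <= 'N[P]_2%:E[EFin \o (f1 \- f2)%R]]) ->
  measurable_suprema P F ->
  (forall n (x : n.-tuple T) (y : n.-tuple R), least_squares F x y !=set0) ->
  exists N : nat, forall n : nat, (N <= n)%N ->
  forall f0, F f0 ->
  forall Psi : set (T -> R) -> T -> R, selection_rule Psi ->
  measurable_fun [set: n.-tuple T * n.-tuple (measurableTypeR R)] (erm_loss P Psi F f0) ->
  c%:E * mine (gaussian_avg P (fun _ : n.-tuple T => F) ^+ 2)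
              (t_crit l P F n f0 ^+ 2)
    <= erm_risk P n Psi F f0].
Proof.
exists (width_ratio R), (risk_ratio R).
split; [exact: width_ratio_itv|exact: risk_ratio_itv|].
move=> d T P F Fcvx Fm F1 [f1 [f2 [Ff1 Ff2 f12]]] mF lsq.
(* Every n >= 1 works; positivity of n is needed to divide by it. *)
exists 1%N => n n0 f0 Ff0 Psi selPsi mL.
have FF : F `<=` F by exact: subset_refl.
have kap0 := std_normal_abs_mean_gt0 R.
have /andP[c0 _] := risk_ratio_itv R.
have n0R : (0 < n%:R :> R)%R by rewrite ltr0n.
have [W [W0 EW E2]] := centered_sup_moments P Fm F1 Ff0 n0 (mF n).1.
have f12' : (4^-1)%:E <= \int[P]_z ((f1 z - f2 z) ^+ 2)%:E.
  rewrite leNgt; apply/negP => lt4.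
  have : 'N[P]_2%:E[EFin \o (f1 \- f2)%R] < (2^-1)%:E.
    have : \int[P]_z ((f1 \- f2)%R z ^+ 2)%:E < (4^-1)%:E by [].
    have : 0 <= \int[P]_z ((f1 \- f2)%R z ^+ 2)%:E.
      by apply: integral_ge0 => z _; rewrite lee_fin sqr_ge0.
    case E : (\int[P]_z _) => [s| |]//; rewrite lee_fin lte_fin => s0 s4.
    have sq4 : (Num.sqrt s < 2^-1)%R.
      rewrite (_ : 2^-1 = Num.sqrt (4^-1) :> R)%R; first by rewrite ltr_sqrt.
      rewrite (_ : 4^-1 = 2^-1 ^+ 2 :> R)%R; last by field.
      by rewrite sqrtr_sqr ger0_norm.
    apply: (@le_lt_trans _ _ (Num.sqrt s)%:E); last by rewrite lte_fin.
    by rewrite Lnorm2_le ?sqrtr_ge0// E lee_fin sqr_sqrtr.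
  by rewrite ltNge f12.
have LB := gaussian_lower_bound Fm F1 Ff0 n0 (mF n).1 Ff1 Ff2 W0 f12' EW.
have Wpos : (0 < W)%R.
  rewrite lt_neqAle W0 andbT; apply/eqP => W00; move: LB.
  rewrite -W00 expr0n /= leNgt => /negP; apply; apply: divr_gt0.
    exact: exprn_gt0.
  by apply: mulr_gt0; [rewrite ltr0n|exact: n0R].
(* The additive 1/n variance term is absorbed into W^2 by the lower bound [LB]. *)
have E2' : \int[power_prob P n]_x \int[power_prob (std_normal R) n]_xi
    (centered_sup f0 F x xi ^+ 2)%:E <= (moment_ratio R * W ^+ 2)%:E.
  apply: (le_trans E2); rewrite lee_fin /moment_ratio [leRHS]mulrDl mul1r lerD2l.
  set s := (4 * _ + _)%R.
  have s0 : (0 <= s)%R.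
    by apply: addr_ge0; apply: mulr_ge0; rewrite ?ler0n ?sqr_ge0
      ?std_normal_sqr_mean_ge0.
  have -> : (s / n%:R = s * 1536 / std_normal_abs_mean R ^+ 2 *
      (std_normal_abs_mean R ^+ 2 / (1536 * n%:R)))%R.
    by field; rewrite !gt_eqF.
  apply: ler_wpM2l; last exact: LB.
  apply: divr_ge0; last exact: sqr_ge0.
  by apply: mulr_ge0; [exact: s0|exact: ler0n].
have WE : gaussian_avg P (fun _ : n.-tuple T => F) = W%:E.
  by rewrite (gaussian_avgE F1 Ff0 (fun=> FF) (fun=> Ff0) Fm (mF n).1).
rewrite WE -EFin_expe.
have : 0 <= erm_risk P n Psi F f0.
  apply: integral_ge0 => w _; apply: integral_ge0 => z _.
  by rewrite lee_fin sqr_ge0.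
have radius t := @risk_ge_of_radius _ _ _ P F f0 n Fm F1 Fcvx Ff0 n0 mF Psi t W
  selPsi (lsq n) mL Wpos EW E2'.
case: (erm_risk P n Psi F f0) radius => [r| |] radius // r0; last by rewrite leey.
rewrite lee_fin in r0.
(* If the risk r already dominates c W^2, the first term of the minimum suffices. Otherwise each
   admissible t > 0 satisfies c t^2 <= r, which bounds the supremum defining the critical radius by
   q = sqrt(r/c). *)
have [cWr|rcW] := leP (risk_ratio R * W ^+ 2)%R r.
  apply: (@le_trans _ _ ((risk_ratio R)%:E * (W ^+ 2)%:E)).
    by apply: lee_wpmul2l; [rewrite lee_fin ltW|rewrite ge_min lexx].
  by rewrite -EFinM lee_fin.
pose q := Num.sqrt (r / risk_ratio R).
have q2 : (q ^+ 2 = r / risk_ratio R)%R by rewrite sqr_sqrtr// divr_ge0// ltW.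
have tq : t_crit (width_ratio R) P F n f0 <= q%:E.
  rewrite /t_crit ge_max lee_fin sqrtr_ge0 /=.
  apply: ge_ereal_sup => _ [t [t0 tcrit] <-]; rewrite lee_fin.
  move: t0; rewrite le_eqVlt => /predU1P[<-|t0]; first exact: sqrtr_ge0.
  have := radius _ t0 tcrit; rewrite lee_fin => ct.
  rewrite -(@ler_pXn2r _ 2) ?nnegrE ?sqrtr_ge0 ?(ltW t0)// q2 ler_pdivlMr// mulrC.
  (* The minimum cannot be W^2, since c W^2 > r in this branch. *)
  move: ct; have [_ h|_ //] := leP (W ^+ 2)%R (t ^+ 2)%R.
  by move: (lt_le_trans rcW h); rewrite ltxx.
have t0 : 0 <= t_crit (width_ratio R) P F n f0 by rewrite /t_crit le_max lexx.
apply: (@le_trans _ _ ((risk_ratio R)%:E * (q ^+ 2)%:E)).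
  apply: lee_wpmul2l; first by rewrite lee_fin ltW.
  rewrite ge_min; apply/orP; right; rewrite EFin_expe !expe2.
  by apply: lee_pmul.
by rewrite -EFinM lee_fin q2 mulrC divfK// gt_eqF.
Qed.
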